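(* If $X$ is a CAT(0) $\mathcal{VH}$-complex, then its simplexification $X^*$ is systolic. If a group $G$ acts geometrically on $X$, then $G$ is systolic.
   Context: Square complexes: a (generalised) square complex is obtained from a set of vertices, edges and squares by gluing along affine embeddings of cells onto faces of cells (closed under composition), with precisely one attaching map onto each proper face of each cell; cells need not be embedded (e.g. an edge may be a loop, or two sides of a square may be glued together). The link at a vertex $v$ is the graph with one vertex for each end of an edge at $v$ and one edge for each corner of a square at $v$, joining the two edge-ends forming that corner. A $\mathcal{VH}$-complex is a square complex whose edges can be partitioned into two classes, vertical and horizontal, such that the attaching map of each square alternates between vertical and horizontal edges. A square complex is nonpositively curved if the link at every vertex contains no embedded combinatorial cycle of length less than $4$ (for a $\mathcal{VH}$-complex: no double edges in vertex links). A CAT(0) $\mathcal{VH}$-complex is a connected, simply connected nonpositively curved $\mathcal{VH}$-complex. Simplicial complexes: a generalised simplicial complex (called ''simplicial complex'' here) is a set of affine simplices together with a set, closed under composition, of affine embeddings (attaching maps) of simplices onto faces of simplices, such that for each proper face of each simplex there is precisely one attaching map onto it; the geometric realisation is the quotient (simplices need not be embedded). The link of a simplex $\sigma$ has one simplex for each attaching map of $\sigma$ into a simplex $\tau$, namely the maximal face of $\tau$ disjoint from the image of $\sigma$, with the restricted attaching maps. A simplicial complex is simple if it has no edge joining a vertex to itself and no pair of simplices with the same boundary (e.g. a double edge). A simple complex is flag if every complete subgraph (clique) of its $1$-skeleton spans a simplex. A cycle without diagonals is an embedded simplicial loop such that no edge of the complex connects two nonconsecutive vertices of it. A simplicial complex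 is locally $6$-large if all its vertex links are flag and contain no cycles of length $4$ or $5$ without diagonals. A systolic complex is a connected, simply connected locally $6$-large simplicial complex. A geometric action on a complex is a proper and cocompact action by automorphisms of the complex. A group is systolic if it admits a geometric action on a systolic complex. Simplexification: let $X$ be a $\mathcal{VH}$-complex with vertex set $V$, set of vertical edges $E_V$ and set of squares $S$. Divide each vertical edge $e\in E_V$ in two by a new vertex $e^*$; the boundary of each square $s$ then becomes a hexagon, and $s$ is subdivided into six triangles by coning this hexagon from a new vertex $s^*$ in its interior. This gives a generalised simplicial complex $\hat X$ triangulating $X$, with vertices $v^*$ ($v\in V$), $e^*$ ($e\in E_V$), $s^*$ ($s\in S$). For $e\in E_V$ with endpoints $v_+,v_-$, let $s_1,\dots,s_n$ be the squares adjacent to $e$, counted with multiplicity (a square both of whose vertical sides are $e$ is counted twice). The complex $X^*$ is obtained from $\hat X$ by attaching, for each $e\in E_V$, two simplices $\sigma^+=v_+^*e^*s_1^*\cdots s_n^*$ and $\sigma^-=v_-^*e^*s_1^*\cdots s_n^*$, glued to each other along their common face $e^*s_1^*\cdots s_n^*$, and with their faces $v_\pm^*e^*s_i^*$ glued to the two triangles of $\hat X$ containing $e^*$ inside the (occurrence of the) square $s_i$. Thus the link of $e^*$ in $\hat X$ is the suspension of $n$ points, whereas in $X^*$ it is the suspension of an $(n-1)$-simplex, and the union of the simplices of $X^*$ containing $e^*$ is the suspension of an $n$-simplex with some pairs of vertices possibly identified.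
   Formalization: The group is assumed to act by automorphisms preserving the partition of edges into vertical and horizontal; if the two classes may be exchanged the second claim fails, e.g. for Z^2 extended by quarter turns acting on the square tiling of the plane. *)

(* Defs.v *)
From HB Require Import structures.
From Stdlib Require Import Relations.
From mathcomp Require Import all_boot finmap.
From mathcomp Require Import boolp classical_sets cardinality.

Set Implicit Arguments.
Unset Strict Implicit.
Unset Printing Implicit Defensive.

(* The fundamental group of a complex is its edge-path group: closed edge paths
   modulo insertion and deletion of backtracks and of boundary loops of 2-cells.
   [joins d u v] says that the oriented edge [d] runs from [u] to [v], [rev]
   reverses oriented edges, and [bd] holds of a boundary loop of each 2-cell
   (its inverse and rotations are then deletable as well). *)

Section EdgePaths.
Variables (V D : Type).
Variables (joins : D -> V -> V -> Prop) (rev : D -> D) (bd : seq D -> Prop).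

Fixpoint edge_path (u : V) (p : seq D) (v : V) : Prop :=
  if p is d :: p' then exists2 w, joins d u w & edge_path w p' v else u = v.

Definition elementary_homotopy (u v : V) (p q : seq D) : Prop :=
  [/\ edge_path u p v, edge_path u q v &
      exists a b r : seq D,
        [/\ p = a ++ r ++ b, q = a ++ b &
            (exists d, r = [:: d; rev d]) \/ bd r]].

Definition homotopic (u v : V) : seq D -> seq D -> Prop :=
  clos_refl_sym_trans (seq D) (elementary_homotopy u v).

Definition edge_connected (is_vertex : V -> Prop) : Prop :=
  (exists u, is_vertex u) /\
  forall u v, is_vertex u -> is_vertex v -> exists p, edge_path u p v.

Definition edge_simply_connected : Prop :=
  forall u p, edge_path u p u -> homotopic u u p [::].

End EdgePaths.

(* A generalised simplicial complex: simplices need not be embedded, and several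
   simplices may share a boundary.  An affine embedding of a simplex onto a face
   is recorded by the injection it induces on vertices. *)
Record scomplex := SComplex {
  simplex : Type;
  vert : simplex -> finType;
  attach : forall s t : simplex, {ffun vert s -> vert t} -> Prop;
  vert_gt0 : forall s, 0 < #|vert s|;
  attach_inj : forall s t (f : {ffun vert s -> vert t}),
    attach f -> injective f;
  attach_proper : forall s t (f : {ffun vert s -> vert t}),
    attach f -> f @: [set: vert s] \proper [set: vert t];
  attach_comp : forall s t u (f : {ffun vert s -> vert t})
      (g : {ffun vert t -> vert u}),
    attach f -> attach g -> attach [ffun x => g (f x)];
  face_unique : forall t (A : {set vert t}),
    A != finset.set0 -> A \proper [set: vert t] ->
    exists! F : {s : simplex & {ffun vert s -> vert t}},
      attach (projT2 F) /\ projT2 F @: [set: vert (projT1 F)] = A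
}.

Section SimplicialNotions.
Variable K : scomplex.
Implicit Types s t u v e : simplex K.

Definition is_vertex v : Prop := #|vert v| = 1.

(* [v] is the vertex of the complex to which the vertex [x] of [s] is glued *)
Definition vertex_at s (x : vert s) v : Prop :=
  is_vertex v /\
  (v = s \/ exists2 f : {ffun vert v -> vert s}, attach f & exists y, f y = x).

Definition has_vertex s v : Prop := exists x : vert s, vertex_at x v.

Definition boundary s : set (simplex K) :=
  [set t | exists f : {ffun vert t -> vert s}, attach f]%classic.

Definition adjacent u v : Prop :=
  u <> v /\ exists e, [/\ #|vert e| = 2, has_vertex e u & has_vertex e v].

(* A point has empty boundary, so the second condition only concerns simplices
   of positive dimension. *)
Definition simple : Prop :=
  (forall e (x y : vert e) v, #|vert e| = 2 ->
     vertex_at x v -> vertex_at y v -> x = y) /\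
  (forall s t, 1 < #|vert s| -> 1 < #|vert t| ->
     boundary s = boundary t -> s = t).

Definition clique (A : set (simplex K)) : Prop :=
  (forall v, A v -> is_vertex v) /\
  (forall u v, A u -> A v -> u <> v -> adjacent u v).

Definition flag : Prop :=
  simple /\
  forall A : set (simplex K), finite_set A -> (A !=set0)%classic -> clique A ->
    exists s, [set v | has_vertex s v]%classic = A.

(* In a simple complex an embedded loop is determined by its cyclic sequence of
   distinct vertices. *)
Definition cycle_without_diagonals (n : nat) (c : 'I_n -> simplex K) : Prop :=
  [/\ injective c, forall i, is_vertex (c i),
      forall i, adjacent (c i) (c (ordS i)) &
      forall i j, adjacent (c i) (c j) -> j = ordS i \/ i = ordS j].

(* an oriented edge: a 1-simplex with its initial and terminal vertex *)
Definition sdart := {e : simplex K & (vert e * vert e)%type}.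

Definition sdart_joins (d : sdart) u v : Prop :=
  [/\ #|vert (projT1 d)| = 2, (projT2 d).1 != (projT2 d).2,
      vertex_at (projT2 d).1 u & vertex_at (projT2 d).2 v].

Definition sdart_rev (d : sdart) : sdart :=
  existT _ (projT1 d) ((projT2 d).2, (projT2 d).1).

Definition sdart_in t (a b : vert t) (d : sdart) : Prop :=
  exists2 f : {ffun vert (projT1 d) -> vert t},
    attach f & f (projT2 d).1 = a /\ f (projT2 d).2 = b.

Definition triangle_boundary (p : seq sdart) : Prop :=
  exists t (a b c : vert t) (d1 d2 d3 : sdart),
    [/\ #|vert t| = 3, uniq [:: a; b; c], p = [:: d1; d2; d3] &
        [/\ sdart_in a b d1, sdart_in b c d2 & sdart_in c a d3]].

Definition sconnected : Prop := edge_connected sdart_joins is_vertex.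

Definition ssimply_connected : Prop :=
  edge_simply_connected sdart_joins sdart_rev triangle_boundary.

End SimplicialNotions.

Lemma existT_inj (T : Type) (P : T -> Type) (x : T) (p q : P x) :
  existT P x p = existT P x q -> p = q.
Proof.
move=> E; have := projT2_eq E.
by rewrite (Prop_irrelevance (projT1_eq E) erefl).
Qed.

Section Link.
Variables (K : scomplex) (s : simplex K).

Definition link_simplex :=
  {t : simplex K & {f : {ffun vert s -> vert t} | attach f}}.

Definition link_target (a : link_simplex) : simplex K := projT1 a.

Definition link_map (a : link_simplex) : {ffun vert s -> vert (link_target a)} :=
  sval (projT2 a).

(* the maximal face disjoint from the image of [s] *)
Definition link_vert (a : link_simplex) : finType :=
  {x : vert (link_target a) | x \notin link_map a @: [set: vert s]}.

(* attaching maps of [K] compatible with the embeddings of [s], restricted *)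
Definition link_attach (a b : link_simplex)
    (g : {ffun link_vert a -> link_vert b}) : Prop :=
  exists h : {ffun vert (link_target a) -> vert (link_target b)},
    [/\ attach h, forall y, h (link_map a y) = link_map b y &
        forall x, val (g x) = h (val x)].

Lemma link_map_attach a : attach (link_map a).
Proof. by rewrite /link_map; case: (projT2 a). Qed.

Lemma link_val_inj a (x y : link_vert a) : val x = val y -> x = y.
Proof. exact: val_inj. Qed.

Lemma link_vert_gt0 a : 0 < #|link_vert a|.
Proof.
have /properP[_ [x _ xN]] := attach_proper (link_map_attach a).
by apply/card_gt0P; exists (exist _ x xN).
Qed.

Lemma link_attach_inj a b (g : {ffun link_vert a -> link_vert b}) :
  link_attach g -> injective g.
Proof.
move=> [h [hh _ gE]] x y /(congr1 val); rewrite !gE => /(attach_inj hh).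
exact: val_inj.
Qed.

Lemma link_attach_proper a b (g : {ffun link_vert a -> link_vert b}) :
  link_attach g -> g @: [set: link_vert a] \proper [set: link_vert b].
Proof.
move=> [h [hh hE gE]]; have /properP[_ [y _ yN]] := attach_proper hh.
have yN' : y \notin link_map b @: [set: vert s].
  apply/imsetP => -[x _ yE]; case/negP: yN.
  by rewrite yE -hE; apply: imset_f.
apply/properP; split; first exact: finset.subsetT.
exists (exist _ y yN') => //; apply/imsetP => -[x _ /(congr1 val)].
rewrite gE /= => yE; case/negP: yN; rewrite yE; exact: imset_f.
Qed.

Lemma link_attach_comp a b c (f : {ffun link_vert a -> link_vert b})
    (g : {ffun link_vert b -> link_vert c}) :
  link_attach f -> link_attach g -> link_attach [ffun x => g (f x)].
Proof.
move=> [h [hh hE fE]] [k [kk kE gE]].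
exists [ffun x => k (h x)]; split=> [|y|x].
- exact: attach_comp.
- by rewrite ffunE hE kE.
- by rewrite !ffunE gE fE.
Qed.

Lemma link_face_unique b (A : {set link_vert b}) :
  A != finset.set0 -> A \proper [set: link_vert b] ->
  exists! F : {a : link_simplex & {ffun link_vert a -> link_vert b}},
    link_attach (projT2 F) /\
    projT2 F @: [set: link_vert (projT1 F)] = A.
Proof.
move=> /set0Pn[x0 x0A] /properP[_ [z _ zA]].
pose I := link_map b @: [set: vert s].
pose A' := I :|: (val @: A).
have IN (x : link_vert b) : val x \notin I by exact: (valP x).
have A'E (x : link_vert b) : (val x \in A') = (x \in A).
  rewrite inE (negPf (IN x)) /=; apply/imsetP/idP => [[y yA /val_inj ->]//|xA].
  by exists x.
have A'0 : A' != finset.set0 by apply/set0Pn; exists (val x0); rewrite A'E.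
have A'p : A' \proper [set: vert (link_target b)].
  apply/properP; split; first exact: finset.subsetT.
  by exists (val z); rewrite // A'E.
have [[t h] [[/= hh hA'] hU]] := face_unique A'0 A'p.
pose B := h @^-1: I.
have x0im : val x0 \in h @: [set: vert t] by rewrite hA' A'E.
have /imsetP[y0 _ y0E] := x0im.
have hB : h @: B = I.
  apply/setP => y; apply/imsetP/idP => [[x]|yI]; first by rewrite inE => ? ->.
  have : y \in h @: [set: vert t] by rewrite hA' inE yI.
  by case/imsetP => x _ yE; exists x => //; rewrite inE -yE.
have B0 : B != finset.set0.
  have /card_gt0P[w _] := vert_gt0 s.
  have : link_map b w \in h @: B by rewrite hB; exact: imset_f.
  by case/imsetP => x xB _; apply/set0Pn; exists x.
have Bp : B \proper [set: vert t].
  apply/properP; split; first exact: finset.subsetT.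
  by exists y0; rewrite // inE -y0E; exact: IN.
have [[s' f] [[/= ff fB] _]] := face_unique B0 Bp.
have I0 : I != finset.set0.
  have /card_gt0P[w _] := vert_gt0 s.
  by apply/set0Pn; exists (link_map b w); exact: imset_f.
have Ip : I \proper [set: vert (link_target b)].
  exact: (attach_proper (link_map_attach b)).
have [F [_ FU]] := face_unique I0 Ip.
have E1 : F = existT _ s' [ffun x => h (f x)].
  apply: FU => /=; split; first exact: attach_comp.
  rewrite -hB -fB -imset_comp; apply: eq_imset => x /=.
  by rewrite ffunE.
have E2 : F = existT _ s (link_map b).
  by apply: FU; split => //; exact: link_map_attach.
have {F FU E1 E2} E : existT (fun s => {ffun vert s -> vert (link_target b)})
    s (link_map b) = existT _ s' [ffun x => h (f x)].
  by rewrite -E1 -E2.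
have [f' [ff' f'E]] : exists f' : {ffun vert s -> vert t},
    attach f' /\ forall y, h (f' y) = link_map b y.
  have ss' := projT1_eq E; simpl in ss'; subst s'.
  by exists f; split=> // y; rewrite (existT_inj E) ffunE.
pose a : link_simplex := existT _ t (exist _ f' ff').
have gP (x : link_vert a) : h (val x) \notin I.
  apply/imsetP => -[y _]; rewrite -f'E => /(attach_inj hh) xE.
  by have := valP x; rewrite xE; case/negP; exact: imset_f.
pose g : {ffun link_vert a -> link_vert b} :=
  [ffun x => exist _ (h (val x)) (gP x)].
exists (existT _ a g); split => /=.
  split; first by exists h; split => // x; rewrite ffunE.
  apply/setP => x; rewrite -A'E -hA'; apply/imsetP/imsetP => -[y _].
    by move=> ->; exists (val y) => //; rewrite ffunE.
  move=> xE; have yN : y \notin link_map a @: [set: vert s].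
    apply/imsetP => -[w _ yE]; have := IN x.
    by rewrite xE yE /link_map /= f'E; case/negP; exact: imset_f.
  exists (exist _ y yN : link_vert a); first by rewrite inE.
  by apply: link_val_inj; rewrite ffunE.
case=> [[t1 [f1 ff1]] g1] /= [[h1 [/= hh1 h1E g1E]] g1A].
have E1 : existT (fun t => {ffun vert t -> vert (link_target b)}) t h
    = existT _ t1 h1.
  apply: (hU (existT _ t1 h1)); split => //=.
  apply/setP => y; apply/imsetP/idP => [[x _ ->]|].
    have [/imsetP[w _ ->]|xN] := boolP (x \in f1 @: [set: vert s]).
      by rewrite [f1]/(link_map (existT _ t1 (exist _ f1 ff1))) h1E
        inE imset_f.
    pose x' : link_vert (existT _ t1 (exist _ f1 ff1)) := exist _ x xN.
    by rewrite -[h1 x]/(h1 (val x')) -g1E A'E -g1A; exact: imset_f.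
  rewrite inE => /orP[/imsetP[w _ ->]|/imsetP[w]].
    by exists (f1 w) => //; rewrite -h1E.
  rewrite -g1A => /imsetP[x _ ->] ->; exists (val x); [by rewrite inE|exact: g1E].
have tt1 := projT1_eq E1; simpl in tt1; subst t1.
have hh1E := existT_inj E1; subst h1.
have f1E : f' = f1.
  apply/ffunP => y; apply: (attach_inj hh); rewrite f'E -h1E //.
subst f1.
have eff : ff' = ff1 by exact: Prop_irrelevance.
subst ff1.
congr existT; apply/ffunP => x; apply: link_val_inj.
by rewrite ffunE; exact: (esym (g1E x)).
Qed.

Definition link : scomplex :=
  SComplex link_vert_gt0 link_attach_inj link_attach_proper link_attach_comp
    link_face_unique.

End Link.

Definition locally_6_large (K : scomplex) : Prop :=
  forall v : simplex K, is_vertex v ->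
    flag (link v) /\
    forall (n : nat) (c : 'I_n -> simplex (link v)),
      n = 4 \/ n = 5 -> ~ cycle_without_diagonals c.

Definition systolic (K : scomplex) : Prop :=
  [/\ sconnected K, ssimply_connected K & locally_6_large K].

(* Proper and cocompact, for an action by automorphisms on a complex, given on
   its set of open cells.  A compact set lies in a finite union of open cells, and
   automorphisms permute the barycentres of cells; hence {g | gK meets K} is
   finite for all compact K iff it is finite for all finite unions of open cells,
   and the quotient is compact iff finitely many cells have translates covering
   the complex. *)
Definition geometric (G : groupType) (C : Type) (act : G -> C -> C) : Prop :=
  (forall A : set C, finite_set A ->
     finite_set [set g | ((act g @` A) `&` A) !=set0]%classic) /\
  (exists2 A : set C, finite_set A &
     (\bigcup_(g in [set: G]) (act g @` A) = [set: C])%classic).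

(* [vact] records the affine maps between simplices through their vertices. *)
Record saction (G : groupType) (K : scomplex) := SAction {
  sact : G -> simplex K -> simplex K;
  vact : forall g s, vert s -> vert (sact g s);
  sact1 : forall s, sact 1%g s = s;
  sactM : forall g h s, sact (g * h)%g s = sact g (sact h s);
  vact1 : forall s (x : vert s),
    existT (fun s => vert s : Type) (sact 1%g s) (vact 1%g x) =
    existT (fun s => vert s : Type) s x;
  vactM : forall g h s (x : vert s),
    existT (fun s => vert s : Type) (sact (g * h)%g s) (vact (g * h)%g x) =
    existT (fun s => vert s : Type) (sact g (sact h s)) (vact g (vact h x));
  vact_attach : forall g s t (f : {ffun vert s -> vert t}), attach f ->
    exists2 f' : {ffun vert (sact g s) -> vert (sact g t)},
      attach f' & forall x, f' (vact g x) = vact g (f x)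
}.

Definition systolic_group (G : groupType) : Prop :=
  exists K : scomplex, systolic K /\
    exists a : saction G K, geometric (sact a).

(* The square is [0,1]^2 with corners [bool * bool]; [d : bool] names a coordinate
   axis ([false] the first, [true] the second).  The side [(d, p)] is the one
   parallel to axis [d] whose other coordinate is [p]. *)

Definition point (d t p : bool) : bool * bool := if d then (p, t) else (t, p).

Definition coord (d : bool) (c : bool * bool) : bool := if d then c.2 else c.1.

(* Having precisely one attaching map onto each proper face means having the
   functions below.  [side s d p] is the edge attached onto the side [(d, p)] of [s]; its end [b]
   goes to the corner with [d]-coordinate [b (+) side_flip s d p].  The last
   field is closure under composition. *)
Record sqcomplex := SqComplex {
  node : choiceType;
  edge : choiceType;
  square : choiceType;
  endpoint : edge -> bool -> node;
  corner : square -> bool * bool -> node;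
  side : square -> bool -> bool -> edge;
  side_flip : square -> bool -> bool -> bool;
  corner_side : forall s d p b,
    corner s (point d (b (+) side_flip s d p) p) = endpoint (side s d p) b
}.

Definition side_map (X : sqcomplex) (s : square X) (d p b : bool) :=
  point d (b (+) side_flip s d p) p.

(* the end of an edge lying on axis [d] at the corner [c] of [s] *)
Definition corner_end (X : sqcomplex) (s : square X) (d : bool)
    (c : bool * bool) : edge X * bool :=
  (side s d (coord (~~ d) c), coord d c (+) side_flip s d (coord (~~ d) c)).

Lemma endpoint_corner_end (X : sqcomplex) (s : square X) d c :
  endpoint (corner_end s d c).1 (corner_end s d c).2 = corner s c.
Proof. by rewrite -corner_side addbK; case: d c => -[x y]. Qed.

Record multigraph := Multigraph {
  gvert : Type;
  gedge : Type;
  gends : gedge -> gvert * gvert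
}.

(* of length 1: a loop; of length 2: a double edge *)
Definition embedded_cycle (L : multigraph) (n : nat) : Prop :=
  exists (c : 'I_n -> gvert L) (k : 'I_n -> gedge L),
    [/\ injective c, injective k &
        forall i, gends (k i) = (c i, c (ordS i)) \/
                  gends (k i) = (c (ordS i), c i)].

Section SquareNotions.
Variable X : sqcomplex.

Definition sqlink_vert (v : node X) :=
  {a : edge X * bool | endpoint a.1 a.2 == v}.

Definition sqlink_edge (v : node X) :=
  {k : square X * (bool * bool) | corner k.1 k.2 == v}.

Lemma sqlink_end_subproof v (k : sqlink_edge v) d :
  let a := corner_end (val k).1 d (val k).2 in endpoint a.1 a.2 == v.
Proof. by rewrite /= endpoint_corner_end; exact: (valP k). Qed.

Definition sqlink_end v (k : sqlink_edge v) d : sqlink_vert v :=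
  exist _ (corner_end (val k).1 d (val k).2) (sqlink_end_subproof k d).

Definition sqlink (v : node X) : multigraph :=
  @Multigraph (sqlink_vert v) (sqlink_edge v)
    (fun k => (sqlink_end k false, sqlink_end k true)).

Definition nonpositively_curved : Prop :=
  forall (v : node X) (n : nat), 0 < n < 4 -> ~ embedded_cycle (sqlink v) n.

(* the edge [a.1], oriented so that it starts at its end [a.2] *)
Definition sqdart_joins (a : edge X * bool) (u v : node X) : Prop :=
  endpoint a.1 a.2 = u /\ endpoint a.1 (~~ a.2) = v.

Definition sqdart_rev (a : edge X * bool) : edge X * bool := (a.1, ~~ a.2).

Definition square_boundary (p : seq (edge X * bool)) : Prop :=
  exists s : square X,
    p = [:: corner_end s false (false, false); corner_end s true (true, false);
            corner_end s false (true, true); corner_end s true (false, true)].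

Definition sqconnected : Prop := edge_connected sqdart_joins (fun=> True).

Definition sqsimply_connected : Prop :=
  edge_simply_connected sqdart_joins sqdart_rev square_boundary.

Definition sqcell := (node X + edge X + square X)%type.

End SquareNotions.

Record vhcomplex := VHComplex {
  vh_sq :> sqcomplex;
  vertical : edge vh_sq -> bool;
  vh_alternate : forall (s : square vh_sq) (d p q : bool),
    vertical (side s (~~ d) q) = ~~ vertical (side s d p)
}.

Definition cat0_vh (X : vhcomplex) : Prop :=
  [/\ sqconnected X, sqsimply_connected X & nonpositively_curved X].

(* An action on [X] by automorphisms.  Automorphisms of a VH-complex preserve
   the two classes of edges, but may reverse edges and permute the corners of
   squares; [edge_act] and [corner_act] record how they act inside cells. *)
Record vhaction (G : groupType) (X : vhcomplex) := VHAction {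
  nact : G -> node X -> node X;
  eact : G -> edge X -> edge X;
  qact : G -> square X -> square X;
  end_act : G -> edge X -> bool -> bool;
  corner_act : G -> square X -> bool * bool -> bool * bool;
  nact1 : forall v, nact 1%g v = v;
  eact1 : forall e, eact 1%g e = e;
  qact1 : forall s, qact 1%g s = s;
  end_act1 : forall e b, end_act 1%g e b = b;
  corner_act1 : forall s c, corner_act 1%g s c = c;
  nactM : forall g h v, nact (g * h)%g v = nact g (nact h v);
  eactM : forall g h e, eact (g * h)%g e = eact g (eact h e);
  qactM : forall g h s, qact (g * h)%g s = qact g (qact h s);
  end_actM : forall g h e b,
    end_act (g * h)%g e b = end_act g (eact h e) (end_act h e b);
  corner_actM : forall g h s c,
    corner_act (g * h)%g s c = corner_act g (qact h s) (corner_act h s c);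
  nact_endpoint : forall g e b,
    nact g (endpoint e b) = endpoint (eact g e) (end_act g e b);
  nact_corner : forall g s c,
    nact g (corner s c) = corner (qact g s) (corner_act g s c);
  eact_side : forall g s d p, exists d' p',
    eact g (side s d p) = side (qact g s) d' p' /\
    forall b, corner_act g s (side_map s d p b) =
              side_map (qact g s) d' p' (end_act g (side s d p) b);
  eact_vertical : forall g e, vertical (eact g e) = vertical e
}.

Definition cell_act (G : groupType) (X : vhcomplex) (a : vhaction G X)
    (g : G) (c : sqcell X) : sqcell X :=
  match c with
  | inl (inl v) => inl (inl (nact a g v))
  | inl (inr e) => inl (inr (eact a g e))
  | inr s => inr (qact a g s)
  end.

(* The simplexification X^* of a VH-complex X.  Each vertical edge e is divided by
   a vertex e^*, each square s becomes a hexagon coned off from a vertex s^*, and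
   for each vertical edge e with ends v_+ and v_-, adjacent to the squares
   s_1, ..., s_n (with multiplicity), one attaches
     sigma^+ = v_+ e^* s_1^* ... s_n^*  and  sigma^- = v_- e^* s_1^* ... s_n^*
   along their common face e^* s_1^* ... s_n^*, gluing the faces v_+- e^* s_i^* to
   the corresponding triangles.  The result is described cell by cell.  All
   simplices being finite, when infinitely many squares are adjacent to e the
   finite faces of sigma^+ and sigma^- are used. *)

Section Simplexification.
Variable X : vhcomplex.

Definition vedge := {e : edge X | vertical e}.
Definition hedge := {e : edge X | ~~ vertical e}.

(* the vertical coordinate axis of a square *)
Definition vaxis (s : square X) : bool := vertical (side s true false).

Lemma vertical_side (s : square X) d p : vertical (side s d p) = (d == vaxis s).
Proof.
rewrite /vaxis; case: d; last first.
  by rewrite (vh_alternate s true false p); case: vertical.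
rewrite (vh_alternate s false false p) (vh_alternate s false false false).
by case: vertical.
Qed.

Lemma vside_subproof s p : vertical (side s (vaxis s) p).
Proof. by rewrite vertical_side. Qed.

Lemma hside_subproof s p : ~~ vertical (side s (~~ vaxis s) p).
Proof. by rewrite vertical_side; case: vaxis. Qed.

(* [vside s p] is the vertical side with horizontal coordinate [p], [hside s q]
   the horizontal side with vertical coordinate [q], and [vhcorner s p q] their
   common corner. *)
Definition vside (s : square X) (p : bool) : vedge :=
  exist _ (side s (vaxis s) p) (vside_subproof s p).
Definition hside (s : square X) (q : bool) : hedge :=
  exist _ (side s (~~ vaxis s) q) (hside_subproof s q).
Definition vhcorner (s : square X) (p q : bool) : node X :=
  corner s (point (vaxis s) q p).

(* the end of [vside s p] at [vhcorner s p q], and of [hside s q] there *)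
Definition vside_end (s : square X) (p q : bool) : bool :=
  q (+) side_flip s (vaxis s) p.
Definition hside_end (s : square X) (p q : bool) : bool :=
  p (+) side_flip s (~~ vaxis s) q.

(* the vertices v^*, e^*, s^* *)
Definition star_vertex := (node X + vedge + square X)%type.
Definition nstar (v : node X) : star_vertex := inl (inl v).
Definition estar (e : vedge) : star_vertex := inl (inr e).
Definition sstar (s : square X) : star_vertex := inr s.

(* Names for the vertices of the simplices sigma^+ and sigma^- of a given
   vertical edge e: [mid] is e^*, [tip b] is the end [b] of e, and [occ s p] is
   the vertex s^* for the occurrence of e as the side [vside s p] of [s]. *)
Definition local_vertex := option (bool + square X * bool).
Definition mid : local_vertex := None.
Definition tip (b : bool) : local_vertex := Some (inl b).
Definition occ (s : square X) (p : bool) : local_vertex := Some (inr (s, p)).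

Definition adjacent_to (e : vedge) (x : local_vertex) : bool :=
  if x is Some (inr (s, p)) then vside s p == e else true.

(* [(e, B)] is the face of sigma^+ or sigma^- with vertex set [B], of positive
   dimension. *)
Definition is_star_face (eB : vedge * {fset local_vertex}) : bool :=
  [&& 1 < #|` eB.2|, ~~ ((tip true \in eB.2) && (tip false \in eB.2)) &
      all (adjacent_to eB.1) (enum_fset eB.2)].
Definition star_face := {eB : vedge * {fset local_vertex} | is_star_face eB}.
Definition star_edge (c : star_face) : vedge := (val c).1.
Definition star_set (c : star_face) : {fset local_vertex} := (val c).2.

(* Faces of sigma^+ and sigma^- of dimension 0 are identified with the vertices
   [star_vertex]; there are no further identifications between them, except that
   the face v_+- s_i^* is also an edge of [HTri].
   The edges of the subdivision of X other than the horizontal edges, and its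
   triangles containing some e^*, are faces of the sigma^+ and sigma^-.  The
   remaining triangle [HTri s q] joins s^* to the side [hside s q]. *)
Inductive star_simplex :=
| Vtx of star_vertex
| HEdge of hedge
| HTri of square X & bool
| SFace of star_face.

(* [HTri s q] has the vertex s^* ([None]) and the corners [vhcorner s p q]
   ([Some p]). *)
Definition star_vert (t : star_simplex) : finType :=
  match t with
  | Vtx _ => unit
  | HEdge _ => bool
  | HTri _ _ => option bool
  | SFace c => star_set c
  end.

Definition star_label (t : star_simplex) : star_vert t -> star_vertex :=
  match t with
  | Vtx w => fun=> w
  | HEdge h => fun b => nstar (endpoint (val h) b)
  | HTri s q => fun x =>
      if x is Some p then nstar (vhcorner s p q) else sstar s
  | SFace c => fun x =>
      match fsval x with
      | None => estar (star_edge c)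
      | Some (inl b) => nstar (endpoint (val (star_edge c)) b)
      | Some (inr (s, _)) => sstar s
      end
  end.

(* The face with corner [Some p] and s^* of [HTri s q] is the segment from s^* to
   the corner [vhcorner s p q], which is a face of sigma^+ or sigma^- for the edge
   [vside s p]. *)
Definition star_attach (t u : star_simplex) :
    {ffun star_vert t -> star_vert u} -> Prop :=
  match t, u with
  | Vtx _, Vtx _ => fun=> False
  | Vtx w, u => fun f : {ffun unit -> star_vert u} => star_label (f tt) = w
  | HEdge h, HTri s q => fun f : {ffun bool -> option bool} =>
      h = hside s q /\ forall p, f (hside_end s p q) = Some p
  | SFace c, SFace c' => fun f : {ffun star_set c -> star_set c'} =>
      [/\ star_edge c = star_edge c',
          (star_set c `<` star_set c')%fset & forall x, fsval (f x) = fsval x]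
  | SFace c, HTri s q => fun f : {ffun star_set c -> option bool} =>
      exists p, [/\ star_edge c = vside s p,
        star_set c = [fset tip (vside_end s p q); occ s p]%fset &
        forall x, f x = if fsval x == occ s p then None else Some p]
  | _, _ => fun=> False
  end.

Lemma star_set_gt1 (c : star_face) : 1 < #|` star_set c|.
Proof. by case/and3P: (valP c). Qed.

Lemma star_set2 (c : star_face) a b :
  star_set c = [fset a; b]%fset ->
  forall z : star_set c, fsval z = a \/ fsval z = b.
Proof.
move=> cE z; have : fsval z \in [fset a; b]%fset by rewrite -cE; exact: valP.
by rewrite !inE => /orP[] /eqP; [left|right].
Qed.

Lemma tip_occ b s p : (tip b == occ s p) = false.
Proof. by []. Qed.

Lemma endpoint_vside (s : square X) p q :
  endpoint (val (vside s p)) (vside_end s p q) = vhcorner s p q.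
Proof. by rewrite /= -corner_side /vside_end addbK. Qed.

Lemma endpoint_hside (s : square X) p q :
  endpoint (val (hside s q)) (hside_end s p q) = vhcorner s p q.
Proof. by rewrite /= -corner_side /hside_end addbK /vhcorner; case: vaxis. Qed.

Lemma star_vert_gt0 t : 0 < #|star_vert t|.
Proof.
case: t => [w|h|s q|c] /=; rewrite ?card_unit ?card_bool ?card_option ?card_bool //.
by rewrite -cardfE (ltn_trans _ (star_set_gt1 c)).
Qed.

Lemma star_attach_inj t u (f : {ffun star_vert t -> star_vert u}) :
  star_attach f -> injective f.
Proof.
case: t u f => [w|h|s q|c] [w'|h'|s' q'|c'] //= f; try by move=> _ [] [].
- move=> [_ fE] x y.
  rewrite -[x](addbK (side_flip s' (~~ vaxis s') q')).
  rewrite -[y](addbK (side_flip s' (~~ vaxis s') q')).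
  by rewrite -/(hside_end s' _ q') !fE => -[->].
- move=> [p [_ cE fE]] x y; rewrite !fE => E; apply: val_inj => /=.
  move: E; have [->|->] := star_set2 cE x;
    have [->|->] := star_set2 cE y; rewrite ?eqxx ?tip_occ; done.
- by move=> [_ _ fE] x y /(congr1 (@fsval _ _)); rewrite !fE => /val_inj.
Qed.

Lemma star_attach_proper t u (f : {ffun star_vert t -> star_vert u}) :
  star_attach f -> f @: [set: star_vert t] \proper [set: star_vert u].
Proof.
move=> ff; rewrite properEcard finset.subsetT /=.
rewrite (card_imset _ (star_attach_inj ff)) !cardsT.
case: t u f ff => [w|h|s q|c] [w'|h'|s' q'|c'] //= f;
  rewrite ?card_unit ?card_option ?card_bool // -?cardfE ?star_set_gt1 //.
- move=> [p [_ cE _]]; rewrite cE.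
  by rewrite cardfs2; case: eqP.
- by move=> [_ /fproper_ltn_card].
Qed.

Lemma star_attach_label t u (f : {ffun star_vert t -> star_vert u}) :
  star_attach f -> forall x, star_label (f x) = star_label x.
Proof.
case: t u f => [w|h|s q|c] [w'|h'|s' q'|c'] //= f; try by move=> fE [].
- move=> [-> fE] x.
  rewrite -{1}[x](addbK (side_flip s' (~~ vaxis s') q')).
  rewrite -/(hside_end s' _ q') fE -endpoint_hside /hside_end addbK //.
- move=> [p [eE cE fE]] x; rewrite fE eE.
  have [->|->] /= := star_set2 cE x.
    by rewrite -endpoint_vside.
  by rewrite eqxx.
- by move=> [eE _ fE] x; rewrite fE eE.
Qed.

Lemma star_attach_comp t u v (f : {ffun star_vert t -> star_vert u})
    (g : {ffun star_vert u -> star_vert v}) :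
  star_attach f -> star_attach g -> star_attach [ffun x => g (f x)].
Proof.
move=> ff gg; have gL := star_attach_label gg.
case: t f ff => [w|h|s q|c] f.
- move=> /star_attach_label/(_ tt) fL.
  have : star_label ([ffun x => g (f x)] tt) = w by rewrite ffunE gL fL.
  case: v g gg {gL} => [w'|h'|s' q'|c'] //= g.
  by case: u f g {fL}.
- by case: u f g gg gL => [w'|h'|s' q'|c'] f g gg _ ff //; case: v g gg.
- by case: u f g gg gL => [w'|h'|s' q'|c'].
- case: u f g gg {gL} => [w'|h'|s' q'|c'] //= f g.
  case: v g => [w''|h''|s'' q''|c''] //= g.
    move=> [p [_ cE _]] [_ /fproper_ltn_card cc' _].
    exfalso; have := leq_ltn_trans (star_set_gt1 c) cc'.
    by rewrite cE cardfs2; case: eqP.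
  move=> [-> cc' gE] [-> c'c fE]; split=> //.
    exact: (fsub_proper_trans (fproper_sub c'c) cc').
  by move=> x; rewrite ffunE gE fE.
Qed.

Lemma star_attach_im_inj t t' u (f : {ffun star_vert t -> star_vert u})
    (g : {ffun star_vert t' -> star_vert u}) :
  star_attach f -> star_attach g ->
  f @: [set: star_vert t] = g @: [set: star_vert t'] ->
  existT (fun t => {ffun star_vert t -> star_vert u}) t f = existT _ t' g.
Proof.
move=> ff gg fg.
have tt' : #|star_vert t| = #|star_vert t'|.
  have := congr1 (fun A : {set star_vert u} => #|A|) fg.
  rewrite (card_imset _ (star_attach_inj ff)) (card_imset _ (star_attach_inj gg)).
  by rewrite !cardsT.
have fgP x : exists y, f x = g y.
  have /imsetP[y _ ->] : f x \in g @: [set: star_vert t'].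
    by rewrite -fg; apply: imset_f; rewrite inE.
  by exists y.
have gt1 (c : star_face) : 1 < #|star_vert (SFace c)|.
  by rewrite /= -cardfE star_set_gt1.
case: t f ff fg tt' fgP => [w|h|s q|c] f ff fg tt' fgP.
- case: t' g gg fg tt' fgP => [w'|h'|s' q'|c'] g gg fg tt' fgP.
  + have [[] E] := fgP tt.
    have := star_attach_label ff tt; rewrite E (star_attach_label gg tt) /= => ww'.
    by subst w'; apply: (congr1 (existT _ _)); apply/ffunP => -[].
  + by move: tt'; rewrite /= card_unit card_bool.
  + by move: tt'; rewrite /= card_unit card_option card_bool.
  + by have := gt1 c'; rewrite -tt' /= card_unit.
- case: u f g gg ff fg fgP => [w'|h'|s q|c'] f g gg ff fg fgP //.
  case: t' g gg fg tt' fgP => [w'|h'|s' q'|c'] g gg fg tt' fgP //.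
  + by move: tt'; rewrite /= card_unit card_bool.
  + case: ff => hE fE; case: gg => hE' gE.
    subst h h'; apply: (congr1 (existT _ _)); apply/ffunP => x.
    by rewrite -[x](addbK (side_flip s (~~ vaxis s) q)) -/(hside_end s _ q) fE gE.
  + case: gg => p [_ cE gE]; case: ff => _ fE.
    have [y] := fgP (hside_end s (~~ p) q); rewrite fE gE.
    by case: eqP => // _ []; case: (p).
- by case: u f g gg ff fg fgP.
- case: u f g gg ff fg fgP => [w'|h'|s q|c''] f g gg ff fg fgP //.
  + case: t' g gg fg tt' fgP => [w'|h'|s' q'|c'] g gg fg tt' fgP //.
    * by have := gt1 c; rewrite tt' /= card_unit.
    * case: ff => p [_ cE fE]; case: gg => _ gE.
      have oc : occ s p \in star_set c by rewrite cE !inE eqxx orbT.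
      have [y] := fgP [` oc]%fset; rewrite fE eqxx.
      by rewrite -[y](addbK (side_flip s (~~ vaxis s) q)) -/(hside_end s _ q) gE.
    * case: ff => p [eE cE fE]; case: gg => p' [eE' cE' gE].
      have oc : tip (vside_end s p q) \in star_set c by rewrite cE !inE eqxx.
      have [y] := fgP [` oc]%fset; rewrite fE gE /=.
      case: eqP => // _ [] pp'; subst p'.
      have cc' : c = c'.
        apply: val_inj; rewrite [val c]surjective_pairing [val c']surjective_pairing.
        by rewrite -/(star_edge c) -/(star_set c) -/(star_edge c') -/(star_set c')
          eE cE eE' cE'.
      by subst c'; apply: (congr1 (existT _ _)); apply/ffunP => x; rewrite fE gE.
  + case: t' g gg fg tt' fgP => [w'|h'|s' q'|c'] g gg fg tt' fgP //.
    * by have := gt1 c; rewrite tt' /= card_unit.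
    * case: ff => eE _ fE; case: gg => eE' _ gE.
      have cc' : c = c'.
        apply: val_inj; rewrite [val c]surjective_pairing [val c']surjective_pairing.
        rewrite -/(star_edge c) -/(star_set c) -/(star_edge c') -/(star_set c').
        rewrite eE eE'; congr pair.
        apply/fsetP => x; apply/idP/idP => xc.
          have [y /(congr1 (@fsval _ _))] := fgP [` xc]%fset.
          by rewrite fE gE /= => ->; exact: valP.
        have : g [` xc]%fset \in f @: [set: star_set c].
          by rewrite fg; apply: imset_f; rewrite inE.
        case/imsetP => y _ /(congr1 (@fsval _ _)).
        by rewrite fE gE /= => ->; exact: valP.
      subst c'; apply: (congr1 (existT _ _)); apply/ffunP => x; apply: val_inj => /=.
      by rewrite fE gE.
Qed.

Lemma star_point_face u (x : star_vert u) : 1 < #|star_vert u| ->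
  star_attach ([ffun=> x] : {ffun star_vert (Vtx (star_label x)) -> star_vert u}).
Proof.
by case: u x => [w|h|s q|c] x /=; rewrite ?card_unit ?ffunE.
Qed.

Lemma star_edge_face s p q : is_star_face
  (vside s p, [fset tip (vside_end s p q); occ s p]%fset).
Proof.
apply/and3P; split=> /=.
- by rewrite cardfs2 tip_occ.
- by rewrite !inE; case: vside_end.
- by apply/allP => x; rewrite !inE => /orP[] /eqP -> /=.
Qed.

Lemma star_sub_face (c : star_face) (B : {fset local_vertex}) :
  1 < #|` B| -> (B `<=` star_set c)%fset -> is_star_face (star_edge c, B).
Proof.
move=> B1 /fsubsetP Bc; have /and3P[_ tipc adjc] := valP c.
apply/and3P; split=> //=.
  by apply: contra tipc => /andP[/Bc ? /Bc ?]; apply/andP.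
by apply/allP => x /Bc xc; exact: (allP adjc).
Qed.

Lemma star_face_ex u (A : {set star_vert u}) :
  A != finset.set0 -> A \proper [set: star_vert u] ->
  exists t (f : {ffun star_vert t -> star_vert u}),
    star_attach f /\ f @: [set: star_vert t] = A.
Proof.
move=> A0 Ap; have Au : #|A| < #|star_vert u|.
  by have := proper_card Ap; rewrite cardsT.
have [A1|] := leqP #|A| 1.
  have /cards1P[x Ax] : #|A| == 1 by rewrite eqn_leq A1 card_gt0.
  exists (Vtx (star_label x)), [ffun=> x]; split.
    by apply: star_point_face; rewrite Ax cards1 in Au.
  apply/setP => y; rewrite Ax inE; apply/imsetP/eqP => [[z _]|->].
    by rewrite ffunE.
  by exists tt; rewrite ?ffunE.
case: u A A0 Ap Au => [w|h|s q|c] A A0 Ap Au A1.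
- by have := leq_trans A1 (ltnW Au); rewrite /= card_unit.
- by have := leq_ltn_trans A1 Au; rewrite /= card_bool.
- have {Au} A2 : #|A| = 2.
    by apply/eqP; rewrite eqn_leq A1 andbT -ltnS; rewrite /= card_option card_bool in Au.
  have /properP[_ [z _ zA]] := Ap.
  have AE : A = ~: [set z].
    apply/eqP; rewrite eqEcard; apply/andP; split.
      by apply/fintype.subsetP => x xA; rewrite !inE; apply: contraNneq zA => <-.
    by rewrite cardsC1 A2 /= card_option card_bool.
  case: z zA AE => [p|] zA AE.
  + pose c : star_face :=
      exist _ (vside s (~~ p), [fset tip (vside_end s (~~ p) q); occ s (~~ p)]%fset)
        (star_edge_face s (~~ p) q).
    exists (SFace c), [ffun x : star_set c =>
      if fsval x == occ s (~~ p) then None else Some (~~ p)].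
    split; first by exists (~~ p); split => // x; rewrite ffunE.
    have tc : tip (vside_end s (~~ p) q) \in star_set c by rewrite !inE eqxx.
    have oc : occ s (~~ p) \in star_set c by rewrite !inE eqxx orbT.
    apply/setP => y; rewrite AE !inE; apply/imsetP/idP => [[x _ ->]|].
      by rewrite ffunE; case: ifP => //; case: (p).
    case: y => [p'|] yp.
      exists [` tc]%fset; rewrite ?inE // ffunE [fsval _ == _]tip_occ.
      by move: yp; case: (p); case: (p').
    by exists [` oc]%fset => //; rewrite ffunE eqxx.
  + exists (HEdge (hside s q)), [ffun b => Some (b (+) side_flip s (~~ vaxis s) q)].
    split; first by split=> // p; rewrite ffunE addbK.
    apply/setP => y; rewrite AE !inE; apply/imsetP/idP => [[x _ ->]|].
      by rewrite ffunE.
    case: y => // p _; exists (hside_end s p q) => //.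
    by rewrite ffunE addbK.
- pose B : {fset local_vertex} := [fset fsval x | x in A]%fset.
  have BE (x : star_set c) : (fsval x \in B) = (x \in A).
    apply/imfsetP/idP => [[y /= yA /val_inj ->]//|xA]; by exists x.
  have Bc : (B `<=` star_set c)%fset.
    by apply/fsubsetP => x /imfsetP[y _ ->]; exact: valP.
  have B1 : 1 < #|` B|.
    rewrite card_imfset /=; last exact: val_inj.
    by rewrite -cardE.
  pose d : star_face := exist _ (star_edge c, B) (star_sub_face B1 Bc).
  exists (SFace d), [ffun x : star_set d => fincl Bc x]; split.
    split=> //=; last by move=> x; rewrite ffunE.
    rewrite fproperEneq Bc andbT; apply/eqP => BcE.
    have /properP[_ [z _ zA]] := Ap.
    by case/negP: zA; rewrite -BE [B]BcE; exact: valP.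
  apply/setP => x; apply/imsetP/idP => [[y _ ->]|].
    by rewrite -BE ffunE; exact: (valP y).
  rewrite -BE => xB; exists [` xB]%fset => //.
  by apply: val_inj; rewrite ffunE.
Qed.

Lemma star_face_unique u (A : {set star_vert u}) :
  A != finset.set0 -> A \proper [set: star_vert u] ->
  exists! F : {t : star_simplex & {ffun star_vert t -> star_vert u}},
    star_attach (projT2 F) /\
    projT2 F @: [set: star_vert (projT1 F)] = A.
Proof.
move=> A0 Ap; have [t [f [ff fA]]] := star_face_ex A0 Ap.
exists (existT _ t f); split=> //= -[t' g] /= [gg gA].
by apply: star_attach_im_inj; rewrite // fA gA.
Qed.

Definition simplexification : scomplex :=
  SComplex star_vert_gt0 star_attach_inj star_attach_proper star_attach_comp
    star_face_unique.

End Simplexification.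

(* Main.v *)
From mathcomp Require Import all_boot finmap.
From mathcomp Require Import boolp classical_sets cardinality.
From Stdlib Require Import Relations.
Require Import Defs.

(* Locally, everything is read off the oriented edges of X^* issuing from a vertex,
   which are the vertices of its link.  The link of e^* is the suspension of a
   simplex.  The link of s^* consists of two such suspensions, one for each vertical
   side of s, whose suspension points are joined by two edges coming from the
   horizontal sides.  The link of v^* is the link of v in X with each edge halved
   and, for each vertical edge end, its vertex and the midpoints of the adjacent
   edges made into a simplex.  In each case an edge of the link either lies in one of
   the simplices sigma^+- or is a bridge, and a cycle of length 4 or 5 through a
   bridge has a diagonal.  Only flagness of the link of v^* uses that X has no double
   edges in its links.

   For the fundamental group, every vertex of X^* is joined to a node of X by a
   spoke, two spokes at the same vertex differ by the image of an edge path of X,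
   and sliding along spokes turns every edge path of X^* into the image of an edge
   path of X, up to homotopy.

   An action on X induces one on X^*.  It is geometric because each simplex of X^*
   is carried by a cell of X, and a cell carries finitely many simplices: a
   geometric action makes X locally finite, so that only finitely many squares are
   adjacent to a given edge. *)

Set Implicit Arguments.
Unset Strict Implicit.
Unset Printing Implicit Defensive.

(** * Complexes with labelled vertices *)

Lemma is_vertex_eq (K : scomplex) (v : simplex K) (x y : vert v) :
  is_vertex v -> x = y.
Proof. by move=> v1; apply: fintype_le1P; rewrite v1. Qed.

Lemma point_face (K : scomplex) (s : simplex K) (x : vert s) :
  exists v, vertex_at x v.
Proof.
have [s1|s1] := eqVneq #|vert s| 1; first by exists s; split=> //; left.
have x0 : [set x]%SET != finset.set0 by apply/set0Pn; exists x; rewrite inE.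
have xp : [set x]%SET \proper [set: vert s]%SET.
  rewrite properEcard finset.subsetT cards1 cardsT ltn_neqAle eq_sym s1.
  exact: vert_gt0.
have [[v f] [[/= fv fx] _]] := face_unique x0 xp.
have v1 : is_vertex v.
  by rewrite /is_vertex -cardsT -(card_imset _ (attach_inj fv)) fx cards1.
have /card_gt0P[y _] := vert_gt0 v.
exists v; split=> //; right; exists f => //; exists y; apply/set1P.
by rewrite -fx imset_f.
Qed.

Section LabelledComplex.
Variables (K : scomplex) (V : Type) (lab : forall s : simplex K, vert s -> V).

(** With the three hypotheses below, a simplex is determined by its set of labels, so [K] behaves
    like a set system on [V]. Simplicity, flagness and cycles then become statements about finite
    sets of labels and [lab_adj]. *)
Definition labels (s : simplex K) : set V := range (@lab s).

Definition lab_adj (u w : V) : Prop :=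
  u <> w /\ exists s, labels s u /\ labels s w.

Lemma lab_adjC u w : lab_adj u w -> lab_adj w u.
Proof. by move=> [uw [s []]]; split; [exact/nesym | exists s]. Qed.

Hypothesis lab_attach : forall s t (f : {ffun vert s -> vert t}),
  attach f -> forall x, lab (f x) = lab x.
Hypothesis lab_inj : forall s, injective (@lab s).
Hypothesis labels_inj : injective labels.

Lemma labels_vertex_at s (x : vert s) v :
  vertex_at x v -> labels v = [set lab x]%classic.
Proof.
move=> [v1 vx]; have [y yx] : exists y : vert v, lab y = lab x.
  case: vx => [->|[f fv [y <-]]]; first by exists x.
  by exists y; rewrite (lab_attach fv).
apply/seteqP; split=> [_ [z _ <-]|_ ->] /=; last by exists y.
by rewrite (is_vertex_eq z y v1).
Qed.

Lemma vertex_atE s (x : vert s) v :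
  is_vertex v -> labels v = [set lab x]%classic -> vertex_at x v.
Proof.
move=> v1 vx; have [v' xv'] := point_face x.
by rewrite (labels_inj (etrans vx (esym (labels_vertex_at xv')))).
Qed.

Lemma labels1 v : is_vertex v -> exists u, labels v = [set u]%classic.
Proof.
move=> v1; have /card_gt0P[y _] := vert_gt0 v.
by exists (lab y); apply: labels_vertex_at; split=> //; left.
Qed.

Lemma has_vertexE s v u : is_vertex v -> labels v = [set u]%classic ->
  has_vertex s v <-> labels s u.
Proof.
move=> v1 vu; split=> [[x /labels_vertex_at]|[x _ xu]].
  by rewrite vu => /seteqP[/(_ u erefl) ux _]; exists x.
by exists x; apply: vertex_atE => //; rewrite xu.
Qed.

(** A simplex of positive dimension has its points in its boundary, so the boundary determines its
    labels and hence the simplex. Injectivity of [lab] on each simplex rules out loops. *)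
Lemma labelled_simple : simple K.
Proof.
split=> [e x y v _ /labels_vertex_at vx /labels_vertex_at vy|s t].
  apply: lab_inj; have : [set lab x]%classic (lab x) by [].
  by rewrite -vx vy.
have sub s' t' : 1 < #|vert s'| -> boundary s' = boundary t' ->
    (labels s' `<=` labels t')%classic.
  move=> s1 st _ [x _ <-]; have [v xv] := point_face x.
  have vx := labels_vertex_at xv.
  have vs : boundary s' v.
    case: xv => v1 [vs|[f fv _]]; last by exists f.
    by move: s1; rewrite -vs v1.
  have : boundary t' v by rewrite -st.
  case=> f fv; have : labels v (lab x) by rewrite vx.
  by case=> y _ <-; exists (f y) => //; rewrite (lab_attach fv).
move=> s1 t1 st; apply: labels_inj; apply/seteqP; split; exact: sub.
Qed.

(** [lab_adj] accepts a simplex of any dimension; the edge demanded by [adjacent] is its face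
    spanned by the two vertices. *)
Lemma adjacentE v w u1 u2 : is_vertex v -> is_vertex w ->
  labels v = [set u1]%classic -> labels w = [set u2]%classic ->
  adjacent v w <-> lab_adj u1 u2.
Proof.
move=> v1 w1 vu wu; split=> [[vw [e [_ ev ew]]]|[u12 [s [[x _ xu] [y _ yu]]]]].
  split=> [u12|]; first by apply: vw; apply: labels_inj; rewrite vu wu u12.
  by exists e; split; [apply/(has_vertexE e v1 vu)|apply/(has_vertexE e w1 wu)].
split=> [vw|].
  have : labels v u1 by rewrite vu.
  by rewrite vw wu.
have xy : x != y by apply/eqP => xy; apply: u12; rewrite -xu -yu xy.
suff [e [e2 eu1 eu2]] : exists e, [/\ #|vert e| = 2, labels e u1 & labels e u2].
  by exists e; split=> //; [apply/(has_vertexE e v1 vu)|apply/(has_vertexE e w1 wu)].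
(* [face_unique] yields proper faces only, so the case where [s] is itself an edge is set apart. *)
have [s2|s2] := eqVneq #|vert s| 2.
  by exists s; split; [|exists x|exists y].
pose A := [set x; y]%SET.
have A2 : #|A| = 2 by rewrite cards2 xy.
have A0 : A != finset.set0 by rewrite -card_gt0 A2.
have Ap : A \proper [set: vert s]%SET.
  rewrite properEcard finset.subsetT A2 cardsT ltn_neqAle eq_sym s2 -A2 -cardsT.
  exact/subset_leq_card/finset.subsetT.
have [[e f] [[/= fe fA] _]] := face_unique A0 Ap.
exists e; split.
- by rewrite -cardsT -(card_imset _ (attach_inj fe)) fA.
- have : x \in f @: [set: vert e]%SET by rewrite fA !inE eqxx.
  by case/imsetP => z _ xz; exists z => //; rewrite -(lab_attach fe) -xz.
- have : y \in f @: [set: vert e]%SET by rewrite fA !inE eqxx orbT.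
  by case/imsetP => z _ yz; exists z => //; rewrite -(lab_attach fe) -yz.
Qed.

(** Each vertex carries exactly one label, so a clique of vertices amounts to a finite set of
    pairwise adjacent labels, and a simplex with these labels spans the clique. *)
Lemma labelled_flag :
  (forall A : set V, finite_set A -> (A !=set0)%classic ->
     (forall u, A u -> exists s, labels s u) ->
     (forall u w, A u -> A w -> u <> w -> lab_adj u w) ->
     exists s, labels s = A) ->
  flag K.
Proof.
move=> fl; split=> [|A Af [v0 Av0] [Av Aadj]]; first exact: labelled_simple.
pose A' : set V := (\bigcup_(v in A) labels v)%classic.
have A'P u : A' u -> exists v, [/\ A v, is_vertex v & labels v = [set u]%classic].
  move=> [v Avv vu]; exists v; split=> //; first exact: Av.
  by have [u' vu'] := labels1 (Av _ Avv); move: vu; rewrite vu' => ->.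
have [|||u w /A'P[v [Avv v1 vu]] /A'P[v' [Avv' v'1 vu']] uw|s sA'] := fl A'.
- by apply: bigcup_finite => // v _; apply: finite_image; exact: finite_finset.
- by have /card_gt0P[y _] := vert_gt0 v0; exists (lab y), v0 => //; exists y.
- by move=> u [v _ vu]; exists v.
- apply/(adjacentE v1 v'1 vu vu'); apply: Aadj => // vv'; apply: uw.
  have : labels v u by rewrite vu.
  by rewrite vv' vu'.
exists s; apply/seteqP; split=> v /=.
  move=> sv; have v1 : is_vertex v by case: sv => x [].
  have [u vu] := labels1 v1.
  have : A' u by rewrite -sA'; apply/(has_vertexE s v1 vu).
  move=> /A'P[w [Aw _ wu]].
  by rewrite (labels_inj (etrans vu (esym wu))).
move=> Avv; have v1 := Av _ Avv; have [u vu] := labels1 v1.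
apply/(has_vertexE s v1 vu); rewrite sA'; exists v => //; by rewrite vu.
Qed.

Lemma labelled_cycle n (c : 'I_n -> simplex K) : cycle_without_diagonals c ->
  exists l : 'I_n -> V, [/\ injective l, forall i, lab_adj (l i) (l (ordS i)) &
    forall i j, lab_adj (l i) (l j) -> j = ordS i \/ i = ordS j].
Proof.
move=> [cI cv ca cd]; have /choice[l lP] i := labels1 (cv i).
exists l; split=> [i j lij|i|i j].
- by apply/cI/labels_inj; rewrite !lP lij.
- exact/(adjacentE (cv _) (cv _) (lP _) (lP _)).
- by move/(adjacentE (cv _) (cv _) (lP _) (lP _))/cd.
Qed.

Lemma labelled_no_cycle4 :
  (forall a b c d, lab_adj a b -> lab_adj b c -> lab_adj c d -> lab_adj d a ->
     a <> c -> b <> d -> lab_adj a c \/ lab_adj b d) ->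
  forall c : 'I_4 -> simplex K, ~ cycle_without_diagonals c.
Proof.
move=> no4 c /labelled_cycle[l [lI la ld]].
have A i j : val j = val (ordS i) -> lab_adj (l i) (l j) by move=> /val_inj ->.
(* Adjacency is turned into a boolean test on indices, which computes to false on each diagonal. *)
have F i j : lab_adj (l i) (l j) -> (val j == val (ordS i)) || (val i == val (ordS j)).
  by move=> /ld[] ->; rewrite eqxx ?orbT.
have D i j : val i != val j -> l i <> l j by move=> /eqP ij /lI /(congr1 val).
pose o i (i4 : i < 4) := Ordinal i4.
by case: (no4 (l (o 0 isT)) (l (o 1 isT)) (l (o 2 isT)) (l (o 3 isT))) => [||||||/F|/F] //;
  solve [exact: A | exact: D].
Qed.

Lemma labelled_no_cycle5 :
  (forall a b c d e, lab_adj a b -> lab_adj b c -> lab_adj c d -> lab_adj d e ->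
     lab_adj e a -> a <> c -> b <> d -> c <> e -> d <> a -> e <> b ->
     [\/ lab_adj a c, lab_adj b d, lab_adj c e | lab_adj d a \/ lab_adj e b]) ->
  forall c : 'I_5 -> simplex K, ~ cycle_without_diagonals c.
Proof.
move=> no5 c /labelled_cycle[l [lI la ld]].
have A i j : val j = val (ordS i) -> lab_adj (l i) (l j) by move=> /val_inj ->.
have F i j : lab_adj (l i) (l j) -> (val j == val (ordS i)) || (val i == val (ordS j)).
  by move=> /ld[] ->; rewrite eqxx ?orbT.
have D i j : val i != val j -> l i <> l j by move=> /eqP ij /lI /(congr1 val).
pose o i (i5 : i < 5) := Ordinal i5.
by case: (no5 (l (o 0 isT)) (l (o 1 isT)) (l (o 2 isT)) (l (o 3 isT)) (l (o 4 isT)))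
  => [||||||||||/F|/F|/F|[/F|/F]] //; solve [exact: A | exact: D].
Qed.

End LabelledComplex.

(** * Links of the simplexification *)

Section NodeLinks.
Variable X : vhcomplex.
Hypothesis npc : nonpositively_curved X.

Lemma coord_point d t p : coord d (point d t p) = t /\ coord (~~ d) (point d t p) = p.
Proof. by case: d. Qed.

Lemma corner_end_v (s : square X) p q :
  corner_end s (vaxis s) (point (vaxis s) q p) = (val (vside s p), vside_end s p q).
Proof. by rewrite /corner_end; case: (coord_point (vaxis s) q p) => -> ->. Qed.

Lemma corner_end_h (s : square X) p q :
  corner_end s (~~ vaxis s) (point (vaxis s) q p) = (val (hside s q), hside_end s p q).
Proof. by rewrite /corner_end negbK; case: (coord_point (vaxis s) q p) => -> ->. Qed.

(** Both corners join the same two edge ends in one vertex link. If they were distinct, they would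
    form a double edge there, that is, an embedded cycle of length 2. *)
Lemma corner_unique (s s' : square X) p p' q q' :
  vside s p = vside s' p' -> vside_end s p q = vside_end s' p' q' ->
  hside s q = hside s' q' -> hside_end s p q = hside_end s' p' q' ->
  s = s' /\ p = p'.
Proof.
move=> vE veE hE heE; apply: contrapT => ne.
have vv : vhcorner s p q = vhcorner s' p' q'.
  by rewrite -!endpoint_vside vE veE.
have aP : endpoint (val (vside s p)) (vside_end s p q) == vhcorner s p q.
  by rewrite endpoint_vside.
have bP : endpoint (val (hside s q)) (hside_end s p q) == vhcorner s p q.
  by rewrite endpoint_hside.
have kP' : corner s' (point (vaxis s') q' p') == vhcorner s p q by rewrite vv.
pose a : sqlink_vert (vhcorner s p q) := exist _ (val (vside s p), vside_end s p q) aP.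
pose b : sqlink_vert (vhcorner s p q) := exist _ (val (hside s q), hside_end s p q) bP.
pose k : sqlink_edge (vhcorner s p q) := exist _ (s, point (vaxis s) q p) (eqxx _).
pose k' : sqlink_edge (vhcorner s p q) := exist _ (s', point (vaxis s') q' p') kP'.
have ab : a <> b.
  move=> /(congr1 val)[] E _; have := valP (vside s p); rewrite /= E.
  by have := valP (hside s q); rewrite /= => /negPf ->.
have kk' : k <> k'.
  move=> /(congr1 val)[] E; subst s' => E; apply: ne; split=> //.
  by have [_ <-] := coord_point (vaxis s) q p; rewrite E; case: (coord_point (vaxis s) q' p').
(* [sqlink_end] indexes the ends of a corner by coordinate axis, so [vaxis] decides which of them is
   the vertical end [a]. *)
have ends (j : sqlink_edge (vhcorner s p q)) :
    j = k \/ j = k' -> forall d, sqlink_end j d = if d == vaxis (val j).1 then a else b.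
  case=> -> d; apply: val_inj => /=; case: eqP => [->|/eqP].
  - exact: corner_end_v.
  - move=> dv; have -> : d = ~~ vaxis s by case: (d) (vaxis s) dv => [] [].
    exact: corner_end_h.
  - by rewrite corner_end_v -vE -veE.
  - move=> dv; have -> : d = ~~ vaxis s' by case: (d) (vaxis s') dv => [] [].
    by rewrite corner_end_h -hE -heE.
apply: (npc (v := vhcorner s p q) (n := 2)) => //.
exists (fun i => if val i == 0 then a else b), (fun i => if val i == 0 then k else k').
split=> [[[|[|//]] ?] [[|[|//]] ?]|[[|[|//]] ?] [[|[|//]] ?]|[[|[|//]] i2]] //=;
  try by [move=> _; apply: val_inj | move/ab | move/esym/ab | move/kk' | move/esym/kk'].
- have e := ends k (or_introl erefl); rewrite !e /=.
  by case: (vaxis s); [right|left].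
- have e := ends k' (or_intror erefl); rewrite !e /=.
  by case: (vaxis s'); [left|right].
Qed.

End NodeLinks.

(* Oriented edges of X^*: [HDart h b] starts at the end [b] of [h], and
   [SDart e x y] runs from [x] to [y] in the simplices around [e]. *)
Inductive star_dart (X : vhcomplex) :=
| NoDart
| HDart of hedge X & bool
| SDart of vedge X & local_vertex X & local_vertex X.
Arguments NoDart {X}.

(** * Oriented edges of X^* as labels for the vertices of the links *)

Section StarLinks.
Variable X : vhcomplex.
Implicit Types (s : square X) (e : vedge X) (h : hedge X) (x y z : local_vertex X).
Implicit Types (t : star_simplex X) (u : star_dart X).

(** The name of an oriented edge must not depend on the simplex containing it, so the sides of
    [HTri s q] through s^* get the names they have around the vertical sides of [s]. Only the values
    at distinct vertices are meaningful. *)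
Definition dart_of t : star_vert t -> star_vert t -> star_dart X :=
  match t with
  | Vtx _ => fun _ _ => NoDart
  | HEdge h => fun b _ => HDart h b
  | HTri s q => fun a b =>
      match a, b with
      | Some p, Some _ => HDart (hside s q) (hside_end s p q)
      | Some p, None => SDart (vside s p) (tip X (vside_end s p q)) (occ s p)
      | None, Some p => SDart (vside s p) (occ s p) (tip X (vside_end s p q))
      | None, None => NoDart
      end
  | SFace c => fun a b => SDart (star_edge c) (fsval a) (fsval b)
  end.

Lemma dart_of_attach t t' (f : {ffun star_vert t -> star_vert t'}) :
  star_attach f -> forall a b, a != b -> dart_of (f a) (f b) = dart_of a b.
Proof.
case: t t' f => [w|h|s q|c] [w'|h'|s' q'|c'] //= f; try by move=> _ [] [].
- move=> [-> fE] a b.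
  have fE' r : f r = Some (r (+) side_flip s' (~~ vaxis s') q').
    by rewrite -fE /hside_end addbK.
  by rewrite !fE' /hside_end addbK.
- move=> [p [-> cE fE]] a b ab; rewrite !fE.
  have [aE|aE] := star_set2 cE a; have [bE|bE] := star_set2 cE b; rewrite aE bE ?eqxx //.
  + by case/eqP: ab; apply: val_inj; rewrite /= aE bE.
  + by case/eqP: ab; apply: val_inj; rewrite /= aE bE.
- by move=> [-> _ fE] a b _; rewrite !fE.
Qed.

Definition dart_set t (a : star_vert t) : set (star_dart X) :=
  [set u | exists2 b, b != a & dart_of a b = u]%classic.

Lemma dart_of_inj t (a b b' : star_vert t) :
  b != a -> b' != a -> dart_of a b = dart_of a b' -> b = b'.
Proof.
case: t a b b' => [w|h|s q|c] /=.
- by move=> [] [].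
- by move=> [] [] [].
- move=> [p|] [p1|] [p2|] //=; last by move=> _ _ [_ ->].
  by rewrite ![Some _ == _]inj_eq; try exact: Some_inj; case: p p1 p2 => [] [] [].
- by move=> a b b' _ _ [/val_inj].
Qed.

Lemma neq_ex2 (c : star_face X) (a : star_set c) : exists b, b != a.
Proof.
have [b] : exists b, b \in ~: [set a]%SET.
  by apply/card_gt0P; rewrite cardsC1 -cardfE -subn1 subn_gt0 star_set_gt1.
by rewrite !inE => ba; exists b.
Qed.

Lemma vside_end_inj s p : injective (vside_end s p).
Proof. exact: addIb. Qed.

(** The kind of simplex is visible in its darts: an [HEdge] gives one [HDart], an [HTri] seen from a
    corner gives both constructors, an [HTri] seen from s^* gives two [SDart] with different starts,
    and an [SFace] gives only [SDart] with a common start. The starts [occ s true] and [occ s false]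
    differ even when both vertical sides of [s] are the same edge. *)
Lemma dart_set_inj t t' (a : star_vert t) (a' : star_vert t') :
  1 < #|star_vert t| -> 1 < #|star_vert t'| -> dart_set a = dart_set a' ->
  existT (fun t => star_vert t : Type) t a = existT (fun t => star_vert t : Type) t' a'.
Proof.
move=> t1 t'1 E.
have sub b : b != a -> exists2 b', b' != a' & dart_of a' b' = dart_of a b.
  by move=> ba; have : dart_set a' (dart_of a b) by rewrite -E; exists b.
have sub' b' : b' != a' -> exists2 b, b != a & dart_of a b = dart_of a' b'.
  by move=> ba; have : dart_set a (dart_of a' b') by rewrite E; exists b'.
move: t1 t'1 {E}.
case: t a sub sub' => [w|h|s q|c] a sub sub'; first by rewrite /= card_unit.
- case: t' a' sub sub' => [w'|h'|s' q'|c'] a' sub sub' _; first by rewrite /= card_unit.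
  + move=> _; have [|b _ /= [-> ->]//] := sub (~~ a); by case: (a).
  + move=> _; case: a' sub sub' => [p|] _ sub'; first by have [] := sub' None.
    by have [] := sub' (Some true).
  + by move=> _; have [b /sub'[]] := neq_ex2 a'.
- case: t' a' sub sub' => [w'|h'|s' q'|c'] a' sub sub' _; first by rewrite /= card_unit.
  + move=> _; case: a sub sub' => [p|] sub _; first by have [] := sub None.
    by have [] := sub (Some true).
  + move=> _; case: a a' sub sub' => [p|] [p'|] sub sub'.
    * have [//|[p1|] //= _ [_ te sE pE]] := sub None.
      by subst s' p'; rewrite (vside_end_inj te).
    * by have [//|[]] := sub' (Some true).
    * by have [//|[]] := sub (Some true).
    * have [//|[p1|] //= _ [_ sE pE te]] := sub (Some true).
      by subst s' p1; rewrite (vside_end_inj te).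
  + move=> _; case: a sub sub' => [p|] sub sub'.
      by have [|? _ //] := sub (Some (~~ p)); case: (p).
    have [//|b1 _ [_ E1 _]] := sub (Some true).
    have [//|b2 _ [_ E2 _]] := sub (Some false).
    by move: E2; rewrite E1.
- case: t' a' sub sub' => [w'|h'|s' q'|c'] a' sub sub' _; first by rewrite /= card_unit.
  + by move=> _; have [b /sub[]] := neq_ex2 a.
  + move=> _; case: a' sub sub' => [p|] sub sub'.
      by have [|? _ //] := sub' (Some (~~ p)); case: (p).
    have [//|b1 _ [_ E1 _]] := sub' (Some true).
    have [//|b2 _ [_ E2 _]] := sub' (Some false).
    by move: E2; rewrite E1.
  + move=> _.
    have [b0 ba] := neq_ex2 a; have [b0' ba' /= [eE aE bE]] := sub _ ba.
    have cc' : c = c'.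
      apply: val_inj; rewrite [val c]surjective_pairing [val c']surjective_pairing.
      rewrite -/(star_edge c) -/(star_set c) -/(star_edge c') -/(star_set c') -eE.
      congr pair; apply/fsetP => z; apply/idP/idP => zc.
        have [->|za] := eqVneq z (fsval a); first by rewrite -aE; exact: valP.
        have [|b' _ [_ _]] := sub [` zc]%fset; first by apply: contraNneq za => <-.
        by move=> <-; exact: valP.
      have [->|za] := eqVneq z (fsval a'); first by rewrite aE; exact: valP.
      have [|b' _ [_ _]] := sub' [` zc]%fset; first by apply: contraNneq za => <-.
      by move=> <-; exact: valP.
    subst c'; congr existT; apply: val_inj; exact/esym.
Qed.

Definition is_tip x : bool := if x is Some (inl _) then true else false.

(** The edges of the suspension formed by sigma^+ and sigma^-: any two distinct vertices around [e]
    are joined, except its two ends. *)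
Definition fits e x y : bool :=
  [&& x != y, adjacent_to e x, adjacent_to e y & ~~ (is_tip x && is_tip y)].

Lemma fitsC e x y : fits e x y = fits e y x.
Proof. by rewrite /fits eq_sym (andbC (is_tip x)); congr andb; rewrite andbCA. Qed.

(** The suspension of a simplex is flag: its only missing edge joins the two suspension points, so
    its faces are the sets of pairwise joined vertices. *)
Lemma is_star_faceP e (B : {fset local_vertex X}) : 1 < #|` B| ->
  reflect (forall x y, x \in B -> y \in B -> x != y -> fits e x y)
    (is_star_face (e, B)).
Proof.
move=> B1; apply: (iffP idP) => [/and3P[_ /= tipB adjB] x y xB yB xy|fB].
  have tips b : tip X b \in B -> tip X (~~ b) \in B -> false.
    by move=> tB fB; move: tipB; case: b tB fB => -> ->.
  apply/and4P; split=> //; [exact: (allP adjB _ xB)|exact: (allP adjB _ yB)|].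
  apply/negP; case: x y xB yB xy => [[b|sp]|] [[b'|sp']|] //= xB yB xy _.
  have b'E : b' = ~~ b by case: b b' xy {xB yB} => [] [].
  by move: (tips b xB); rewrite -b'E => /(_ yB).
apply/and3P; split=> //=.
  by apply/andP => -[tB fB']; have := fB _ _ tB fB' isT.
(* Adjacency of [x] to [e] is read off [fits] with a second element, which exists by [B1]. *)
apply/allP => x xB; have [y yB yx] : exists2 y, y \in B & y != x.
  apply: contrapT => H; move: B1; rewrite ltnNge => /negP; apply.
  rewrite -(cardfs1 x); apply: fsubset_leq_card; apply/fsubsetP => y yB.
  rewrite inE; apply/negP => /negP yx; apply: H; by exists y.
by have /and4P[] := fB _ _ yB xB yx.
Qed.

(** The formula of [star_label] on an [SFace], available without choosing a face that contains
    [x]. *)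
Definition local_label e x : star_vertex X :=
  match x with
  | None => estar e
  | Some (inl b) => nstar (endpoint (val e) b)
  | Some (inr (s, _)) => sstar s
  end.

Lemma star_face_fits (c : star_face X) (a b : star_set c) : b != a ->
  fits (star_edge c) (fsval a) (fsval b).
Proof.
move=> ba; have /is_star_faceP P : is_star_face (star_edge c, star_set c).
  by rewrite -surjective_pairing; exact: (valP c).
apply: P; [exact: star_set_gt1|exact: valP|exact: valP|].
by apply: contraNneq ba => ab; apply/eqP; apply: val_inj.
Qed.

Definition sigma_adj (u u' : star_dart X) : Prop :=
  exists e x y z, [/\ u = SDart e x y, u' = SDart e x z,
    fits e x y, fits e x z & fits e y z].

(* [BridgeN] comes from the triangle [HTri s q] seen from its corner [Some p], and
   [BridgeS] from the same triangle seen from s^*. *)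
Variant bridge : star_dart X -> star_dart X -> Prop :=
| BridgeN s p q : bridge (HDart (hside s q) (hside_end s p q))
    (SDart (vside s p) (tip X (vside_end s p q)) (occ s p))
| BridgeS s p q : bridge
    (SDart (vside s p) (occ s p) (tip X (vside_end s p q)))
    (SDart (vside s (~~ p)) (occ s (~~ p)) (tip X (vside_end s (~~ p) q))).

(** Points and [HEdge] have no two distinct darts at a vertex, an [HTri] yields a bridge at each of
    its three vertices, and an [SFace] yields [sigma_adj]. *)
Lemma dart_set_adj t (a : star_vert t) u u' :
  dart_set a u -> dart_set a u' -> u <> u' ->
  [\/ sigma_adj u u', bridge u u' | bridge u' u].
Proof.
move=> [b ba <-] [b' b'a <-].
case: t a b b' ba b'a => [w|h|s q|c] a b b' ba b'a.
- by case: a b ba b'a => [] [].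
- by [].
- case: a b b' ba b'a => [p|] [p1|] [p2|] //= ba b'a.
  + by constructor 2; constructor.
  + by constructor 3; constructor.
  + have [->//|p12] := eqVneq p1 p2.
    have {p12} -> : p2 = ~~ p1 by case: p1 p2 p12 {ba b'a} => [] [].
    by move=> _; constructor 2; constructor.
move=> /= ne; constructor 1.
exists (star_edge c), (fsval a), (fsval b), (fsval b'); split=> //.
- exact: star_face_fits.
- exact: star_face_fits.
- by apply: star_face_fits; apply: contra_not_neq ne => ->.
Qed.

Section AtVertex.
Variable w : star_vertex X.

Notation lk := (link (Vtx w : simplex (simplexification X))).

(** A vertex of the link is an oriented edge issuing from [w]; the orientation keeps apart the two
    ends of a loop at [w]. *)
Definition link_lab (a : simplex lk) (x : vert a) : star_dart X :=
  dart_of (link_map a tt : star_vert (link_target a)) (val x).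

Lemma link_target_gt1 (a : simplex lk) : 1 < #|star_vert (link_target a)|.
Proof.
have := attach_proper (link_map_attach a) => /proper_card.
rewrite cardsT (card_imset _ (attach_inj (link_map_attach a))) cardsT.
exact/leq_trans/vert_gt0.
Qed.

Lemma link_lab_set (a : simplex lk) :
  labels link_lab a = dart_set (link_map a tt : star_vert (link_target a)).
Proof.
apply/seteqP; split=> [_ [x _ <-]|_ [b ba <-]].
  exists (val x) => //; apply: contra (valP x) => /eqP ->.
  by apply: imset_f; rewrite inE.
have bN : b \notin link_map a @: [set: vert (Vtx w : simplex (simplexification X))]%SET.
  by apply: contra ba => /imsetP[[] _ ->].
by exists (exist _ b bN).
Qed.

Lemma link_lab_attach (a b : simplex lk) (f : {ffun vert a -> vert b}) :
  attach f -> forall v, link_lab (f v) = link_lab v.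
Proof.
move=> [k [kk kE fE]] x; rewrite /link_lab fE -kE.
apply: (dart_of_attach (f := k)) => //.
by apply: contra (valP x) => /eqP <-; apply: imset_f; rewrite inE.
Qed.

Lemma link_lab_inj (a : simplex lk) : injective (@link_lab a).
Proof.
move=> x y /dart_of_inj E; apply: val_inj; apply: E.
  by apply: contra (valP x) => /eqP ->; apply: imset_f; rewrite inE.
by apply: contra (valP y) => /eqP ->; apply: imset_f; rewrite inE.
Qed.

(** By [dart_set_inj] the labels recover the target simplex and the vertex of it glued to [w]. A map
    from a point is determined by its image, so these two data are the link simplex. *)
Lemma link_labels_inj : injective (labels link_lab).
Proof.
move=> a b; rewrite !link_lab_set => /dart_set_inj E.
have {E} := E (link_target_gt1 a) (link_target_gt1 b).
case: a => t [f ff]; case: b => t' [f' ff']; rewrite /link_map /= => E.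
have tt' := projT1_eq E; simpl in tt'; subst t'.
have E' := existT_inj E.
have ff'E : f = f' by apply/ffunP => -[].
by subst f'; rewrite (Prop_irrelevance ff ff').
Qed.

Lemma link_simplex_ex t (a : star_vert t) : 1 < #|star_vert t| ->
  star_label a = w -> exists b, labels link_lab b = dart_set a.
Proof.
move=> t1 aw; have := star_point_face a t1; rewrite aw => fa.
exists (existT _ t (exist _ _ fa) : simplex lk).
by rewrite link_lab_set /link_map /= ffunE.
Qed.

Notation adj := (lab_adj link_lab).

Lemma adj_cases u u' : adj u u' -> [\/ sigma_adj u u', bridge u u' | bridge u' u].
Proof.
by move=> [ne [a []]]; rewrite !link_lab_set => ua u'a; exact: dart_set_adj ua u'a ne.
Qed.

Lemma label_SDart (a : simplex lk) e x y :
  labels link_lab a (SDart e x y) -> fits e x y /\ local_label e x = w.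
Proof.
rewrite link_lab_set => -[b ba].
have := star_attach_label (link_map_attach a) tt.
move: (link_map a tt) b ba; case: (link_target a) => [w'|h|s q|c] a' b //=.
  case: a' b => [p|] [p'|] //= _ aw [<- <- <-]; split=> //.
  - by rewrite /fits /= eqxx.
  - by rewrite -aw -endpoint_vside.
  - by rewrite /fits /= eqxx.
move=> ba aw [<- <- <-]; split; first exact: star_face_fits.
by rewrite -aw.
Qed.

Lemma label_HDart (a : simplex lk) h b :
  labels link_lab a (HDart h b) -> nstar (endpoint (val h) b) = w.
Proof.
rewrite link_lab_set => -[c ca].
have := star_attach_label (link_map_attach a) tt.
move: (link_map a tt) c ca; case: (link_target a) => [w'|h'|s q|c'] a' c //=.
  by move=> _ aw [<- <-].
case: a' c => [p|] [p'|] //= _ aw [<- <-].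
by rewrite -aw -endpoint_hside.
Qed.

Lemma label_NoDart (a : simplex lk) : ~ labels link_lab a NoDart.
Proof.
rewrite link_lab_set => -[c ca].
have := star_attach_label (link_map_attach a) tt.
move: (link_target_gt1 a).
move: (link_map a tt) c ca; case: (link_target a) => [w'|h'|s q|c'] a' c //=.
by case: a' c => [p|] [p'|].
Qed.

Lemma sface_labels e x (B : {fset local_vertex X}) :
  local_label e x = w -> 1 < #|` B| -> x \in B ->
  (forall y z, y \in B -> z \in B -> y != z -> fits e y z) ->
  exists a, labels link_lab a =
    [set u | exists y, [/\ y \in B, y != x & u = SDart e x y]]%classic.
Proof.
move=> xw B1 xB /(is_star_faceP e B1) eB.
pose c : star_face X := exist _ (e, B) eB.
have [|//|a aE] := @link_simplex_ex (SFace c) [` xB]%fset; first by rewrite /= -cardfE.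
exists a; rewrite aE; apply/seteqP; split=> [_ [b bx <-]|_ [y [yB yx ->]]].
  exists (fsval b); split=> //; exact: valP.
by exists ([` yB]%fset : star_vert (SFace c)) => //; apply: contra yx => /eqP <-.
Qed.

Lemma adj_SDart e x y z : local_label e x = w ->
  fits e x y -> fits e x z -> fits e y z -> adj (SDart e x y) (SDart e x z).
Proof.
move=> xw xy xz yz; split=> [[E]|]; first by move: yz; rewrite E /fits eqxx.
have [xNy xNz] : x != y /\ x != z by move: xy xz => /and4P[? _ _ _] /and4P[].
pose B := [fset x; y; z]%fset.
have B1 : 1 < #|` B|.
  have : ([fset x; y] `<=` B)%fset by apply/fsubsetP => v; rewrite !inE => ->.
  by move=> /fsubset_leq_card; rewrite cardfs2 xNy.
have [|v v'|a aE] := sface_labels xw B1; first by rewrite !inE eqxx.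
  by rewrite !inE => /orP[/orP[]|] /eqP -> /orP[/orP[]|] /eqP ->;
    rewrite ?eqxx // => _; rewrite fitsC.
by exists a; rewrite aE; split;
  [exists y|exists z]; split=> //; rewrite ?inE ?eqxx ?orbT // eq_sym.
Qed.

(** A horizontal edge lies in no sigma^+ or sigma^-, so each neighbour is reached across a
    bridge. *)
Lemma adj_HDart h b u : adj (HDart h b) u -> exists s p q,
  [/\ h = hside s q, b = hside_end s p q &
      u = SDart (vside s p) (tip X (vside_end s p q)) (occ s p)].
Proof.
move=> /adj_cases[[? [? [? [? []]]]]//|E|E].
  by inversion E; exists s, p, q.
by inversion E.
Qed.

Lemma adj_tip e b y u : adj (SDart e (tip X b) y) u ->
  (exists2 z, fits e y z & u = SDart e (tip X b) z) \/
  (exists s p q, [/\ SDart e (tip X b) y =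
      SDart (vside s p) (tip X (vside_end s p q)) (occ s p) &
      u = HDart (hside s q) (hside_end s p q)]).
Proof.
move=> /adj_cases[[e' [x [y' [z [[<- <- <-] -> _ _ yz]]]]]|E|E].
- by left; exists z.
- by inversion E.
- by inversion E; right; exists s, p, q.
Qed.

(** A bridge at s^* leads to the opposite vertical side. [BridgeS] is symmetric under exchanging the
    sides, so both orientations give the same formula. *)
Lemma adj_occ e s p y u : adj (SDart e (occ s p) y) u ->
  (exists2 z, fits e y z & u = SDart e (occ s p) z) \/
  (exists q, y = tip X (vside_end s p q) /\
    u = SDart (vside s (~~ p)) (occ s (~~ p)) (tip X (vside_end s (~~ p) q))).
Proof.
move=> /adj_cases[[e' [x [y' [z [[<- <- <-] -> _ _ yz]]]]]|E|E].
- by left; exists z.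
- by right; inversion E; exists q.
- by right; inversion E; exists q; subst; rewrite negbK.
Qed.

End AtVertex.
End StarLinks.

(** * Cycles of length 4 and 5 in the links *)

Section AtVertex.
Variable X : vhcomplex.
Variable w : star_vertex X.

Notation adj := (lab_adj (@link_lab X w)).

Implicit Types (s : square X) (p q : bool) (e : vedge X) (h : hedge X).
Implicit Types (x y z : local_vertex X) (a b c d u v : star_dart X).

Let adjC := (@lab_adjC _ _ (@link_lab X w)).

Lemma adj_fits u e x y : adj u (SDart e x y) -> fits e x y /\ local_label e x = w.
Proof. by move=> [_ [a [_ /label_SDart]]]. Qed.

Lemma adj_same_base e x y z u v : adj u (SDart e x y) -> adj v (SDart e x z) ->
  fits e y z -> adj (SDart e x y) (SDart e x z).
Proof. by move=> /adj_fits[xy xw] /adj_fits[xz _] yz; exact: adj_SDart. Qed.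

Lemma SDart_inj e x y e' x' y' : SDart (X := X) e x y = SDart e' x' y' ->
  [/\ e = e', x = x' & y = y'].
Proof. by case. Qed.

Lemma node_corner_inj s p q s' p' q' :
  SDart (X := X) (vside s p) (tip X (vside_end s p q)) (occ s p) =
    SDart (vside s' p') (tip X (vside_end s' p' q')) (occ s' p') ->
  [/\ s = s', p = p' & q = q'].
Proof.
by move=> /SDart_inj[_ [te] [sE pE]]; subst s' p'; rewrite (vside_end_inj te).
Qed.

(** By [node_corner_inj] this dart is an end of a single bridge; its other neighbours stay in its
    own suspension. *)
Lemma adj_node_corner s p q u :
  adj (SDart (vside s p) (tip X (vside_end s p q)) (occ s p)) u ->
  u <> HDart (hside s q) (hside_end s p q) ->
  exists y, u = SDart (vside s p) (tip X (vside_end s p q)) y.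
Proof.
move=> /adj_tip[[y _ ->] _|[s' [p' [q' [/node_corner_inj[<- <- <-] -> //]]]]].
by exists y.
Qed.

(** Apart from the bridge, neighbours stay in the same suspension. The dart itself points to an end
    of the vertical edge, so they do not. *)
Lemma adj_square_corner s p q u :
  adj (SDart (vside s p) (occ s p) (tip X (vside_end s p q))) u ->
  u <> SDart (vside s (~~ p)) (occ s (~~ p)) (tip X (vside_end s (~~ p) q)) ->
  exists y, u = SDart (vside s p) (occ s p) y /\ ~~ is_tip y.
Proof.
move=> /adj_occ[[y /and4P[_ _ _ ty] ->] _|[q' [[/vside_end_inj <-] -> //]]].
by exists y.
Qed.

Lemma adj_SDart_mid e e' x x' y y' :
  adj (SDart e x y) (SDart e' x' y') -> e = e' /\ x = x' \/
  [/\ is_tip y, is_tip y' & ~~ is_tip x].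
Proof.
by move=> /adj_cases[[e1 [x1 [y1 [z [[-> -> _] [-> -> _] _ _ _]]]]]|E|E];
  [left|inversion E; right..].
Qed.

Lemma fits_occ e s p s' p' y z : fits e y (occ s p) -> fits e z (occ s' p') ->
  occ s p <> occ s' p' -> fits e (occ s p) (occ s' p').
Proof. by move=> /and4P[_ _ sp _] /and4P[_ _ sp' _] /eqP ne; apply/and4P. Qed.

(** For [BridgeN], [d] is again a corner dart since it is a neighbour of [a], and the edge from [c]
    to [d] forces [b] and [d] into one suspension, where both point to square centres and so are
    joined. For [BridgeS], [c] and [d] lie at opposite vertical sides and do not point to ends, so
    they cannot be adjacent. *)
Lemma bridge_square a b c d : bridge a b -> adj a b -> adj b c -> adj c d ->
  adj d a -> a <> c -> b <> d -> adj b d.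
Proof.
case=> s p q ab bc cd da ac bd.
- have [s' [p' [q' [hE heE dE]]]] := adj_HDart (adjC da); subst d.
  have [y cE] := adj_node_corner bc (nesym ac); subst c.
  have [[eE tE]|[_]//] := adj_SDart_mid cd.
  move: cd da ab bc bd; rewrite -eE -tE => cd da ab bc bd.
  apply: (adj_same_base ab cd).
  apply: (fits_occ (proj1 (adj_fits ab)) (proj1 (adj_fits cd))) => E.
  by apply: bd; rewrite E.
- have [y [cE yt]] := adj_square_corner (p := ~~ p) bc
    ltac:(by rewrite negbK; exact: nesym); subst c.
  have [y' [dE y't]] := adj_square_corner (adjC da) (nesym bd); subst d.
  have [[_ []]|[yt' _ _]] := adj_SDart_mid cd; first by case: (p).
  by rewrite yt' in yt.
Qed.

(** For [BridgeN], [c] lies in the suspension of [b] and [d] in that of [e]; the edge between them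
    identifies the two suspensions, where [b] and [e] both point to square centres. For [BridgeS],
    neither [c] nor [e] points to an end, so [d] would have to lie at both vertical sides. *)
Lemma bridge_pentagon a b c d (e : star_dart X) : bridge a b -> adj a b -> adj b c -> adj c d ->
  adj d e -> adj e a -> a <> c -> e <> b -> d <> a -> d <> b -> adj b e.
Proof.
case=> s p q ab bc cd de ea ac eb da db.
- have [s' [p' [q' [hE heE eE]]]] := adj_HDart (adjC ea); subst e.
  have [y cE] := adj_node_corner bc (nesym ac); subst c.
  have [z dE] : exists y, d = SDart (vside s' p') (tip X (vside_end s' p' q')) y.
    by apply: adj_node_corner (adjC de) _; rewrite -hE -heE.
  subst d; have [[vE tE]|[_ _]//] := adj_SDart_mid cd.
  move: cd de ea ab bc eb; rewrite -vE -tE => cd de ea ab bc eb.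
  apply: (adj_same_base ab de).
  apply: (fits_occ (proj1 (adj_fits ab)) (proj1 (adj_fits de))) => E.
  by apply: eb; rewrite E.
- have [y [cE yt]] := adj_square_corner (p := ~~ p) bc
    ltac:(by rewrite negbK; exact: nesym); subst c.
  have [y' [eE y't]] := adj_square_corner (adjC ea) eb; subst e.
  have dc : exists z, d = SDart (vside s (~~ p)) (occ s (~~ p)) z.
    have [[z _ ->]|[r [yE]]] := adj_occ cd; first by exists z.
    by rewrite yE in yt.
  have de' : exists z, d = SDart (vside s p) (occ s p) z.
    have [[z _ ->]|[r [yE]]] := adj_occ (adjC de); first by exists z.
    by rewrite yE in y't.
  by case: dc de' => z -> [z' [_ []]]; case: (p).
Qed.

Lemma sigma_adj_fits e x y z :
  sigma_adj (SDart e x y) (SDart e x z) -> fits e y z.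
Proof.
move=> [e' [x' [y' [z' [/SDart_inj[-> _ ->] /SDart_inj[_ _ ->] _ _ //]]]]].
Qed.

(** Three consecutive such edges put all four darts into one suspension. If neither diagonal were
    present, all four would point to ends of the edge, contradicting that [a] and [b] are joined. *)
Lemma sigma_adj_square a b c d : sigma_adj a b -> sigma_adj b c ->
  sigma_adj c d -> adj a b -> adj b c -> adj c d -> a <> c -> b <> d ->
  adj a c \/ adj b d.
Proof.
move=> Sab; have := Sab.
move=> [e [x [ya [yb [aE bE _ _ _]]]]]; subst a b; move=> [_ [_ [_ [yc [[<- <- _] -> _ _ _]]]]].
move=> [_ [_ [_ [yd [[<- <- _] -> _ _ _]]]]] ab bc cd ac bd.
have [fa xw] := adj_fits (adjC ab); have [fb _] := adj_fits ab.
have [fc _] := adj_fits bc; have [fd _] := adj_fits cd.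
have acn : ya != yc by apply: contra_not_neq ac => ->.
have bdn : yb != yd by apply: contra_not_neq bd => ->.
have [/andP[ta tc]|nac] := boolP (is_tip ya && is_tip yc); last first.
  by left; apply: adj_SDart => //; case/and4P: fa fc => ? ? ? ? /and4P[? ? ? ?]; apply/and4P.
have [/andP[tb td]|nbd] := boolP (is_tip yb && is_tip yd); last first.
  by right; apply: adj_SDart => //; case/and4P: fb fd => ? ? ? ? /and4P[? ? ? ?]; apply/and4P.
have fab : fits e ya yb.
  exact: sigma_adj_fits Sab.
by move: fab => /and4P[_ _ _]; rewrite ta tb.
Qed.

(** If one of the first three edges is a bridge, the cycle is rotated or reflected so that
    [bridge_square] applies; otherwise they lie in one suspension. *)
Lemma no_square a b c d : adj a b -> adj b c -> adj c d -> adj d a ->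
  a <> c -> b <> d -> adj a c \/ adj b d.
Proof.
move=> ab bc cd da ac bd.
have ba := adjC ab; have cb := adjC bc; have dc := adjC cd; have ad := adjC da.
have ca := nesym ac; have db := nesym bd.
have [Sab|B|B] := adj_cases ab; last first.
- by left; apply: (bridge_square B ba ad dc cb).
- by right; apply: (bridge_square B ab bc cd da).
have [Sbc|B|B] := adj_cases bc; last first.
- by right; apply: (bridge_square B cb ba ad dc).
- by left; apply/adjC/(bridge_square B bc cd da ab).
have [Scd|B|B] := adj_cases cd; last first.
- by left; apply/adjC/(bridge_square B dc cb ba ad).
- by right; apply/adjC/(bridge_square B cd da ab bc).
exact: sigma_adj_square Sab Sbc Scd ab bc cd ac bd.
Qed.

(** As for squares: a bridge among the first three edges is moved to the front, and without one the
    first four vertices already have a diagonal. *)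
Lemma no_pentagon a b c d (e : star_dart X) : adj a b -> adj b c -> adj c d -> adj d e ->
  adj e a -> a <> c -> b <> d -> c <> e -> d <> a -> e <> b ->
  [\/ adj a c, adj b d, adj c e | adj d a \/ adj e b].
Proof.
move=> ab bc cd de ea ac bd ce da eb.
have ba := adjC ab; have cb := adjC bc; have dc := adjC cd.
have ed := adjC de; have ae := adjC ea.
have [Sab|B|B] := adj_cases ab; last first.
- by constructor 1; apply: (bridge_pentagon B ba ae ed dc cb) => //; exact: nesym.
- by constructor 4; right; apply/adjC/(bridge_pentagon B ab bc cd de ea) => //; exact: nesym.
have [Sbc|B|B] := adj_cases bc; last first.
- by constructor 2; apply: (bridge_pentagon B cb ba ae ed dc) => //; exact: nesym.
- by constructor 1; apply/adjC/(bridge_pentagon B bc cd de ea ab) => //; exact: nesym.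
have [Scd|B|B] := adj_cases cd; last first.
- by constructor 3; apply: (bridge_pentagon B dc cb ba ae ed) => //; exact: nesym.
- by constructor 2; apply/adjC/(bridge_pentagon B cd de ea ab bc) => //; exact: nesym.
by have [|] := sigma_adj_square Sab Sbc Scd ab bc cd ac bd; [constructor 1|constructor 2].
Qed.

(** * Flagness of the links *)

Hypothesis npc : nonpositively_curved X.

(** For [BridgeN], a common neighbour would be a second corner with the same vertical and horizontal
    ends, which [corner_unique] excludes. For [BridgeS], it would be a dart at the side of [b] not
    pointing to an end, and such a dart is not joined to [a]. *)
Lemma bridge_maximal a b c : bridge a b -> adj a b -> adj a c -> adj b c -> False.
Proof.
case=> s p q ab ac bc.
- have [s' [p' [q' [hE heE cE]]]] := adj_HDart ac; subst c.
  have [[vE [tE]]|[_]//] := adj_SDart_mid bc.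
  have [sE pE] := corner_unique npc vE tE hE heE.
  by case: bc => ne _; apply: ne; rewrite vE tE sE pE.
- have [y [cE yt]] := adj_square_corner (p := ~~ p) bc
    ltac:(by rewrite negbK => E; case: ac => /(_ (esym E))); subst c.
  have [[z _ /SDart_inj[_ [pE] _]]|[r [_ /SDart_inj[_ _ yE]]]] := adj_occ ac.
    by case: (p) pE.
  by rewrite yE in yt.
Qed.

Notation lk := (link (Vtx w : simplex (simplexification X))).

Lemma bridge_simplex a b : bridge a b -> adj a b ->
  exists s : simplex lk, labels (@link_lab X w) s = [set a; b]%classic.
Proof.
case=> s p q ab.
- have [||k kE] := @link_simplex_ex X w (HTri s q) (Some p).
  + by rewrite /= card_option card_bool.
  + have [_ [k [/label_HDart vw _]]] := ab.
    by rewrite /= -endpoint_hside.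
  exists k; rewrite kE; apply/seteqP; split=> [_ [[p'|] pp' <-]|_ [->|->]] /=.
  + by left.
  + by right.
  + by exists (Some (~~ p)) => //; case: (p).
  + by exists None.
- have [||k kE] := @link_simplex_ex X w (HTri s q) None.
  + by rewrite /= card_option card_bool.
  + by have [_ <-] := adj_fits ab.
  exists k; rewrite kE; apply/seteqP; split=> [_ [[p'|] pp' <-]|_ [->|->]] //=.
  + have [->|pp''] := eqVneq p' p; first by left.
    have -> : p' = ~~ p by case: (p) (p') pp'' => [] [].
    by right.
  + by exists (Some p).
  + by exists (Some (~~ p)).
Qed.

Lemma HDart_simplex k h (b : bool) : labels (@link_lab X w) k (HDart h b) ->
  exists s : simplex lk, labels (@link_lab X w) s = [set HDart h b]%classic.
Proof.
move=> /label_HDart vw.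
have [|//|k' kE] := @link_simplex_ex X w (HEdge h) b; first by rewrite /= card_bool.
exists k'; rewrite kE; apply/seteqP; split=> [_ [b' _ <-]//|_ ->].
by exists (~~ b) => //; case: (b).
Qed.

(** All elements start at [x] around [e], so [A] is given by the finite set of their targets. These
    targets and [x] are pairwise joined and hence form a face. *)
Lemma SDart_simplex (A : set (star_dart X)) e x y : finite_set A ->
  A (SDart e x y) -> fits e x y -> local_label e x = w ->
  (forall u, A u -> u <> SDart e x y -> sigma_adj (SDart e x y) u) ->
  (forall u v, A u -> A v -> u <> v -> sigma_adj u v) ->
  exists s : simplex lk, labels (@link_lab X w) s = A.
Proof.
move=> Af Axy xy xw Ay Auv.
have AE u : A u -> exists2 z, fits e x z & u = SDart e x z.
  move=> Au; have [->|uy] := EM (u = SDart e x y); first by exists y.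
  by have [_ [_ [_ [z [[<- <- _] -> _ fz _]]]]] := Ay _ Au uy; exists z.
have /finite_fsetP[B BE] : finite_set [set z | A (SDart e x z)]%classic.
  by apply: (@finite_preimage _ _ A (SDart e x)) => // z z' _ _ [].
have BP z : z \in B <-> A (SDart e x z).
  by have /seteqP[s1 s2] := BE; split; [exact: s2|exact: s1].
have xB z : z \in B -> fits e x z.
  by move=> /BP/AE[z' xz' [->]].
have xnB z : z \in B -> z != x by move=> /xB/and4P[]; rewrite eq_sym.
have [|||s sE] := @sface_labels X w e x (x |` B)%fset xw.
- rewrite cardfsU1 (_ : x \notin B); last by apply/negP => /xnB; rewrite eqxx.
  by rewrite ltnS cardfs_gt0; apply/fset0Pn; exists y; apply/BP.
- by rewrite !inE eqxx.
- move=> z z'; rewrite !inE => /orP[/eqP ->|zB] /orP[/eqP ->|z'B] zz'.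
  + by rewrite eqxx in zz'.
  + exact: xB.
  + by rewrite fitsC; exact: xB.
  + apply: sigma_adj_fits (Auv _ _ (proj1 (BP z) zB) (proj1 (BP z') z'B) _).
    by case=> E; rewrite E eqxx in zz'.
exists s; rewrite sE; apply/seteqP; split=> [_ [z [zB zx ->]]|u Au] /=.
  by apply/BP; move: zB; rewrite !inE (negPf zx).
have [z xz uE] := AE _ Au; exists z; rewrite uE in Au *.
have zB : z \in B by apply/BP.
by split=> //; [rewrite !inE zB orbT|exact: xnB].
Qed.

(** A clique containing a bridge consists of its two ends by [bridge_maximal]. A clique without
    bridges is a single horizontal dart or lies in one suspension. *)
Lemma link_flag_cond (A : set (star_dart X)) : finite_set A -> (A !=set0)%classic ->
  (forall u, A u -> exists s : simplex lk, labels (@link_lab X w) s u) ->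
  (forall u v, A u -> A v -> u <> v -> adj u v) ->
  exists s : simplex lk, labels (@link_lab X w) s = A.
Proof.
move=> Af [u Au] Alab Aadj.
have [[a [b [Aa Ab B]]]|nB] := EM (exists a b, [/\ A a, A b & bridge a b]).
  have ne : a <> b by case: B => // s p q /SDart_inj[_ [pE] _]; case: (p) pE.
  have [s sE] := bridge_simplex B (Aadj _ _ Aa Ab ne).
  exists s; rewrite sE; apply/seteqP; split=> [_ [->|->]//|c Ac].
  apply: contrapT => /not_orP[ca cb].
  by apply: (bridge_maximal (c := c) B (Aadj _ _ Aa Ab ne)); apply: Aadj => // E;
    [apply: ca|apply: cb].
have AS a b : A a -> A b -> a <> b -> sigma_adj a b.
  move=> Aa Ab ne; have [//|B|B] := adj_cases (Aadj _ _ Aa Ab ne);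
    case: nB; first by exists a, b.
  by exists b, a.
have [k ku] := Alab _ Au; case: u Au ku => [|h b|e x y] Au ku.
- by case: (label_NoDart ku).
(* [sigma_adj] relates no [HDart], so the clique has this single element. *)
- have [s sE] := HDart_simplex ku; exists s; rewrite sE.
  apply/seteqP; split=> [_ ->//|c Ac]; apply: contrapT => ne.
  by have [? [? [? [? []]]]] := AS _ _ Au Ac (nesym ne).
- have [xy xw] := label_SDart ku.
  apply: (SDart_simplex Af Au xy xw) => // v Av vne; apply: AS => //; exact: nesym.
Qed.

End AtVertex.

Lemma is_vertexP (X : vhcomplex) (v : simplex (simplexification X)) :
  is_vertex v -> exists w, v = Vtx w.
Proof.
case: v => [w|h|s q|c] v1; first by exists w.
- by move: v1; rewrite /is_vertex /= card_bool.
- by move: v1; rewrite /is_vertex /= card_option card_bool.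
- by have := star_set_gt1 c; rewrite cardfE -/(is_vertex _) v1.
Qed.

Lemma star_locally_6_large (X : vhcomplex) : nonpositively_curved X ->
  locally_6_large (simplexification X).
Proof.
move=> npc v /is_vertexP[w ->].
have la := @link_lab_attach X w; have li := @link_lab_inj X w.
have ll := @link_labels_inj X w.
split=> [|n c nE].
  by apply: (labelled_flag la li ll); exact: link_flag_cond.
case: nE c => -> c.
- by apply: (labelled_no_cycle4 la ll (@no_square X w)).
- by apply: (labelled_no_cycle5 la ll (@no_pentagon X w)).
Qed.

(** * Calculus of edge-path homotopies *)

Section Homotopy.
Variables (V D : Type) (joins : D -> V -> V -> Prop) (rv : D -> D).
Variable bd : seq D -> Prop.

Notation path := (edge_path joins).

Lemma edge_path_cat u p q v :
  path u (p ++ q) v <-> exists2 w, path u p w & path w q v.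
Proof.
elim: p u => [|d p IH] u /=; first by split=> [?|[w -> //]]; exists u.
split=> [[w dw /IH[w' pw' qw']]|[w' [w dw pw'] qw']].
  by exists w' => //; exists w.
by exists w => //; apply/IH; exists w'.
Qed.

Lemma path_cat u v w p q : path u p v -> path v q w -> path u (p ++ q) w.
Proof. by move=> up vq; apply/edge_path_cat; exists v. Qed.

(** [homotopic] is reflexive even on sequences that are not paths, so being a path is carried
    along. *)
Definition heq (u v : V) (p q : seq D) : Prop :=
  [/\ path u p v, path u q v & homotopic joins rv bd u v p q].

Lemma heq_refl u v p : path u p v -> heq u v p p.
Proof. by move=> ?; split=> //; apply: rst_refl. Qed.

Lemma heq_sym u v p q : heq u v p q -> heq u v q p.
Proof. by move=> [? ? ?]; split=> //; apply: rst_sym. Qed.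

Lemma heq_trans u v q p r : heq u v p q -> heq u v q r -> heq u v p r.
Proof. by move=> [? _ H1] [_ ? H2]; split=> //; apply: rst_trans H1 H2. Qed.

Lemma heq_cat u v w p p' q q' :
  heq u v p p' -> heq v w q q' -> heq u w (p ++ q) (p' ++ q').
Proof.
move=> [up up' pp'] [vq vq' qq'].
apply: (@heq_trans _ _ (p' ++ q)); (split; try exact: (@path_cat _ v)).
- elim: pp' => [a b [ua ub [c [d [r [aE bE rE]]]]]|?|? ? _ ?|? z ? _ xz _ zy].
  + subst a b; apply: rst_step; split; try exact: (@path_cat _ v).
    by exists c, (d ++ q), r; rewrite -!catA.
  + exact: rst_refl.
  + exact: rst_sym.
  + exact: rst_trans xz zy.
- elim: qq' => [a b [ua ub [c [d [r [aE bE rE]]]]]|?|? ? _ ?|? z ? _ xz _ zy].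
  + subst a b; apply: rst_step; split; try exact: (@path_cat _ v).
    by exists (p' ++ c), d, r; rewrite -!catA.
  + exact: rst_refl.
  + exact: rst_sym.
  + exact: rst_trans xz zy.
Qed.

Lemma heq_catl u v w p q q' : path u p v -> heq v w q q' -> heq u w (p ++ q) (p ++ q').
Proof. by move/heq_refl; apply: heq_cat. Qed.

Lemma heq_catr u v w p p' q : heq u v p p' -> path v q w -> heq u w (p ++ q) (p' ++ q).
Proof. by move=> pp' /heq_refl; apply: heq_cat. Qed.

Lemma heq_rev u v d : joins d u v -> joins (rv d) v u -> heq u u [:: d; rv d] [::].
Proof.
move=> uv vu; have P : path u [:: d; rv d] u by exists v => //; exists u.
split=> //; apply: rst_step; split=> //; exists [::], [::], [:: d; rv d].
by split=> //; left; exists d.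
Qed.

Lemma heq_bd u r : path u r u -> bd r -> heq u u r [::].
Proof.
move=> ur br; split=> //; apply: rst_step; split=> //; exists [::], [::], r.
by split; rewrite ?cats0 //; right.
Qed.

(** [q] is an inverse of both: [p] and [q'] are each homotopic to [p ++ q ++ q']. *)
Lemma heq_loop u v p q q' : path u p v -> path v q u -> path u q' v ->
  heq u u (p ++ q) [::] -> heq v v (q ++ q') [::] -> heq u v p q'.
Proof.
move=> up vq uq' pq qq'; apply: (heq_trans (q := p ++ q ++ q')).
  by apply: heq_sym; rewrite -[X in heq _ _ _ X]cats0; apply: heq_catl qq'.
by rewrite catA -[X in heq _ _ _ X]cat0s; apply: heq_catr pq uq'.
Qed.

End Homotopy.

(** * Edge paths of the simplexification *)

Section StarPaths.
Variable X : vhcomplex.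
Implicit Types (s : square X) (p q b : bool) (e : vedge X) (h : hedge X).
Implicit Types (x y z : local_vertex X) (u v w : star_vertex X).

Notation K := (simplexification X).
Notation pt w := (Vtx w : simplex K).
Notation spath u p v := (edge_path (@sdart_joins K) (pt u) p (pt v)).
Notation sheq u v p q := (heq (@sdart_joins K) (@sdart_rev K)
  (@triangle_boundary K) (pt u) (pt v) p q).

Lemma star_vertex_atP (t : simplex K) (a : vert t) (v : simplex K) :
  vertex_at a v <-> v = pt (star_label (a : star_vert t)).
Proof.
have point w : is_vertex (pt w) by rewrite /is_vertex /= card_unit.
split=> [[/is_vertexP[w ->] [E|[f ff [c <-]]]]|->].
- by subst t; case: a.
- by rewrite (star_attach_label ff); case: c.
split; first exact: point.
have [t1|] := ltnP 1 #|star_vert t|.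
  right; exists [ffun=> a]; first exact: star_point_face t1.
  by exists tt; rewrite ffunE.
move=> t1; left; case: t a t1 => [w|h|s q|c] a t1 //.
- by move: t1; rewrite /= card_bool.
- by move: t1; rewrite /= card_option card_bool.
- by move: t1; rewrite leqNgt /= -cardfE star_set_gt1.
Qed.

Definition hdart h b : sdart K := existT _ (HEdge h : simplex K) (b, ~~ b).

Lemma hdart_joins h b : sdart_joins (hdart h b)
  (pt (nstar (endpoint (val h) b))) (pt (nstar (endpoint (val h) (~~ b)))).
Proof.
split=> /=; [by rewrite card_bool|by case: b|exact/star_vertex_atP|exact/star_vertex_atP].
Qed.

Lemma fits_face e x y : fits e x y -> is_star_face (e, [fset x; y]%fset).
Proof.
move=> xy; have xNy : x != y by case/and4P: xy.
apply/is_star_faceP => [|z z']; first by rewrite cardfs2 xNy.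
by rewrite !inE => /orP[] /eqP -> /orP[] /eqP ->; rewrite ?eqxx // fitsC.
Qed.

Definition fits_dart e x y (xy : fits e x y) : sdart K :=
  existT (fun t => (vert t * vert t)%type)
    (SFace (exist _ (e, [fset x; y]%fset) (fits_face xy) : star_face X) : simplex K)
    ([` fset21 x y]%fset, [` fset22 x y]%fset).

(* junk value [[::]] if [x] and [y] are not adjacent *)
Definition seg e x y : seq (sdart K) :=
  if pselect (fits e x y) is left xy then [:: fits_dart xy] else [::].

Lemma segE e x y (xy : fits e x y) : seg e x y = [:: fits_dart xy].
Proof. by rewrite /seg; case: pselect => // xy'; rewrite (bool_irrelevance xy xy'). Qed.

Lemma star_face_eq (c c' : star_face X) :
  star_edge c = star_edge c' -> star_set c = star_set c' -> c = c'.
Proof.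
move=> eE sE; apply: val_inj.
by rewrite [LHS]surjective_pairing [RHS]surjective_pairing; congr pair.
Qed.

Lemma sface_dart_eq (c c' : star_face X) (a b : star_set c) (a' b' : star_set c') :
  star_edge c = star_edge c' -> star_set c = star_set c' ->
  fsval a = fsval a' -> fsval b = fsval b' ->
  existT (fun t => (vert t * vert t)%type) (SFace c : simplex K) (a, b) =
  existT _ (SFace c' : simplex K) (a', b').
Proof.
move=> eE sE aE bE; have cc' := star_face_eq eE sE.
by subst c'; rewrite (val_inj aE) (val_inj bE).
Qed.

Lemma fits_dart_joins e x y (xy : fits e x y) : sdart_joins (fits_dart xy)
  (pt (local_label e x)) (pt (local_label e y)).
Proof.
have xNy : x != y by case/and4P: xy.
split=> /=; [by rewrite -cardfE cardfs2 xNy| |exact/star_vertex_atP|exact/star_vertex_atP].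
by apply: contra xNy => /eqP/(congr1 (@fsval _ _))/= ->.
Qed.

Lemma seg_path e x y : fits e x y -> spath (local_label e x) (seg e x y) (local_label e y).
Proof.
move=> xy; rewrite (segE xy); exists (pt (local_label e y)) => //.
exact: fits_dart_joins.
Qed.

Lemma seg_back e x y : fits e x y ->
  sheq (local_label e x) (local_label e x) (seg e x y ++ seg e y x) [::].
Proof.
move=> xy; have yx := xy; rewrite fitsC in yx; rewrite (segE xy) (segE yx).
(* Both orientations live on the same simplex, whose vertex set is unordered. *)
have -> : fits_dart yx = sdart_rev (fits_dart xy).
  by apply: sface_dart_eq => //; exact: fsetUC.
apply: heq_rev; first exact: fits_dart_joins.
have -> : sdart_rev (fits_dart xy) = fits_dart yx.
  by apply: sface_dart_eq => //; exact: fsetUC.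
exact: fits_dart_joins.
Qed.

Lemma fits_dart_in e x y (B : {fset local_vertex X}) (eB : is_star_face (e, B))
    (xy : fits e x y) (xB : x \in B) (yB : y \in B) : ([fset x; y] `<` B)%fset ->
  @sdart_in K (SFace (exist _ (e, B) eB : star_face X)) [` xB]%fset [` yB]%fset
    (fits_dart xy).
Proof.
move=> sub; exists [ffun z : [fset x; y]%fset => fincl (fproper_sub sub) z].
  by split=> //= z; rewrite ffunE.
by split; apply: val_inj; rewrite ffunE.
Qed.

(** Three pairwise joined vertices span a triangle of sigma^+ or sigma^-, whose boundary can be
    deleted. *)
Lemma seg_triangle e x y z : fits e x y -> fits e y z -> fits e x z ->
  sheq (local_label e x) (local_label e z) (seg e x y ++ seg e y z) (seg e x z).
Proof.
move=> xy yz xz; have zx := xz; rewrite fitsC in zx.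
have loop : sheq (local_label e x) (local_label e x)
    (seg e x y ++ seg e y z ++ seg e z x) [::].
  apply: heq_bd.
    by apply: path_cat (seg_path xy) _; apply: path_cat (seg_path yz) _; apply: seg_path.
  have [xNy yNz xNz] : [/\ x != y, y != z & x != z].
    by split; [case/and4P: xy|case/and4P: yz|case/and4P: xz].
  pose B := [fset x; y; z]%fset.
  have B3 : #|` B| = 3.
    by rewrite /B fsetUC cardfsU1 cardfs2 xNy !inE negb_or eq_sym xNz eq_sym yNz.
  have [xB yB zB] : [/\ x \in B, y \in B & z \in B] by rewrite !inE !eqxx ?orbT.
  have eB : is_star_face (e, B).
    apply/is_star_faceP => [|v v']; first by rewrite B3.
    by rewrite !inE => /orP[/orP[]|] /eqP -> /orP[/orP[]|] /eqP ->;
      rewrite ?eqxx // => _; rewrite fitsC.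
  have sub a c : a \in B -> c \in B -> ([fset a; c] `<` B)%fset.
    move=> aB cB; rewrite fproperEcard B3 cardfs2 ltnS; case: eqP => _; rewrite andbT;
    by apply/fsubsetP => r; rewrite inE => /orP[] /fset1P ->.
  exists (SFace (exist _ (e, B) eB : star_face X)), [` xB]%fset, [` yB]%fset, [` zB]%fset.
  rewrite (segE xy) (segE yz) (segE zx).
  exists (fits_dart xy), (fits_dart yz), (fits_dart zx); split=> //.
  - by rewrite /= -cardfE B3.
  - by rewrite /= !inE -!val_eqE /= negb_or xNy xNz yNz.
  - by split; apply: fits_dart_in; exact: sub.
apply: (heq_loop (q := seg e z x)); rewrite -?catA //; try exact: seg_path.
  by apply: path_cat; apply: seg_path.
exact: seg_back.
Qed.

Lemma fits_tip_occ s p q : fits (vside s p) (tip X (vside_end s p q)) (occ s p).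
Proof. by rewrite /fits /= eqxx. Qed.

Lemma fits_tip_mid e b : fits e (tip X b) (mid X).
Proof. by []. Qed.

Lemma fits_mid_occ s p : fits (vside s p) (mid X) (occ s p).
Proof. by rewrite /fits /= eqxx. Qed.

Lemma hdart_path h b : spath (nstar (endpoint (val h) b)) [:: hdart h b]
  (nstar (endpoint (val h) (~~ b))).
Proof. by exists (pt (nstar (endpoint (val h) (~~ b)))) => //; exact: hdart_joins. Qed.

Lemma hdart_back h b : sheq (nstar (endpoint (val h) b)) (nstar (endpoint (val h) b))
  [:: hdart h b; hdart h (~~ b)] [::].
Proof.
have -> : hdart h (~~ b) = sdart_rev (hdart h b) by rewrite /sdart_rev /= /hdart negbK.
apply: heq_rev; first exact: hdart_joins.
have -> : sdart_rev (hdart h b) = hdart h (~~ b) by rewrite /sdart_rev /= /hdart negbK.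
by have := hdart_joins h (~~ b); rewrite negbK.
Qed.

(** * Spokes from the centre of a square to its corners *)

Definition square_spoke s p q := seg (vside s p) (occ s p) (tip X (vside_end s p q)).

Lemma square_spoke_path s p q : spath (sstar s) (square_spoke s p q) (nstar (vhcorner s p q)).
Proof.
have := @seg_path (vside s p) (occ s p) (tip X (vside_end s p q)).
by rewrite fitsC fits_tip_occ /= endpoint_vside; apply.
Qed.

(** The triangle [HTri s q] fills the loop made of two spokes and a horizontal side. *)
Lemma square_spoke_h s p q : sheq (sstar s) (nstar (vhcorner s (~~ p) q))
  (square_spoke s p q ++ [:: hdart (hside s q) (hside_end s p q)]) (square_spoke s (~~ p) q).
Proof.
have ot := fits_tip_occ s p q; rewrite fitsC in ot; have to := fits_tip_occ s (~~ p) q.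
have ot' := to; rewrite fitsC in ot'.
have hp : spath (nstar (vhcorner s p q)) [:: hdart (hside s q) (hside_end s p q)]
    (nstar (vhcorner s (~~ p) q)).
  have := hdart_path (hside s q) (hside_end s p q).
  have -> : ~~ hside_end s p q = hside_end s (~~ p) q by rewrite /hside_end addNb.
  by rewrite !endpoint_hside.
have bp : spath (nstar (vhcorner s (~~ p) q))
    (seg (vside s (~~ p)) (tip X (vside_end s (~~ p) q)) (occ s (~~ p))) (sstar s).
  by have := seg_path to; rewrite /= endpoint_vside.
apply: (heq_loop (q := seg (vside s (~~ p)) (tip X (vside_end s (~~ p) q)) (occ s (~~ p)))).
- exact: path_cat (square_spoke_path s p q) hp.
- exact: bp.
- exact: square_spoke_path.
- apply: heq_bd; first exact: path_cat (path_cat (square_spoke_path s p q) hp) bp.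
  exists (HTri s q : simplex K), None, (Some p), (Some (~~ p)).
  rewrite /square_spoke (segE ot) (segE to).
  exists (fits_dart ot), (hdart (hside s q) (hside_end s p q)), (fits_dart to).
  split=> //; first by rewrite /= card_option card_bool.
    by case: (p).
  split.
  + exists [ffun x => if fsval x == occ s p then None else Some p].
      by exists p; split=> // [|x]; rewrite ?ffunE //; exact: fsetUC.
    by rewrite !ffunE /= eqxx.
  + exists [ffun b => Some (b (+) side_flip s (~~ vaxis s) q)].
      by split=> // p'; rewrite ffunE addbK.
    by rewrite !ffunE /= /hside_end addbK addNb addbK.
  + exists [ffun x => if fsval x == occ s (~~ p) then None else Some (~~ p)].
      by exists (~~ p); split=> // x; rewrite ffunE.
    by rewrite !ffunE /= eqxx.
- by have := seg_back to; rewrite /= endpoint_vside.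
Qed.

(** The two triangles of [s] at the midpoint of the vertical side, one in sigma^+ and one in
    sigma^-, are crossed in turn. *)
Lemma square_spoke_v s p q : sheq (sstar s) (nstar (vhcorner s p (~~ q)))
  (square_spoke s p q ++ seg (vside s p) (tip X (vside_end s p q)) (mid X) ++
     seg (vside s p) (mid X) (tip X (~~ vside_end s p q))) (square_spoke s p (~~ q)).
Proof.
have om := fits_mid_occ s p; rewrite fitsC in om.
have ot q' := fits_tip_occ s p q'; have to := ot q; rewrite fitsC in to.
have to' := ot (~~ q); rewrite fitsC in to'.
have -> : ~~ vside_end s p q = vside_end s p (~~ q) by rewrite /vside_end addNb.
rewrite -endpoint_vside catA.
apply: (heq_trans (q := seg (vside s p) (occ s p) (mid X) ++
     seg (vside s p) (mid X) (tip X (vside_end s p (~~ q))))).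
  apply: (heq_catr (v := pt (estar (vside s p)))).
    exact: (seg_triangle to (fits_tip_mid _ _) om).
  exact: (@seg_path _ (mid X) (tip X _)).
exact: (@seg_triangle _ (occ s p) (mid X) (tip X _)).
Qed.

(** * Images in X^* of edge paths of X *)

Implicit Types (n m : node X).

Notation xpath := (edge_path (@sqdart_joins X)).

(** A vertical edge is traversed through its midpoint e^*. [pselect] supplies the proof needed to
    view the edge as an element of [vedge] or [hedge]. *)
Definition star_edge_path (a : edge X * bool) : seq (sdart K) :=
  match pselect (vertical a.1) with
  | left av => let e : vedge X := exist _ a.1 av in
      seg e (tip X a.2) (mid X) ++ seg e (mid X) (tip X (~~ a.2))
  | right av => [:: hdart (exist _ a.1 (introN idP av)) a.2]
  end.

Lemma star_edge_path_v e b : star_edge_path (val e, b) =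
  seg e (tip X b) (mid X) ++ seg e (mid X) (tip X (~~ b)).
Proof.
rewrite /star_edge_path /=; case: pselect => [ev|[]]; last exact: (valP e).
by have -> : exist _ (val e) ev = e by exact: val_inj.
Qed.

Lemma star_edge_path_h h b : star_edge_path (val h, b) = [:: hdart h b].
Proof.
rewrite /star_edge_path /=; case: pselect => [hv|nv].
  by have := valP h; rewrite /= hv.
by congr [:: hdart _ _]; exact: val_inj.
Qed.

Lemma vh_edgeP (e : edge X) : (exists e' : vedge X, e = val e') \/
  (exists h : hedge X, e = val h).
Proof.
have [ev|hv] := boolP (vertical e); first by left; exists (exist _ e ev).
by right; exists (exist _ e hv).
Qed.

Lemma star_edge_pathP (a : edge X * bool) : spath (nstar (endpoint a.1 a.2))
  (star_edge_path a) (nstar (endpoint a.1 (~~ a.2))).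
Proof.
case: a => e b; have [[e' ->]|[h ->]] := vh_edgeP e.
  rewrite star_edge_path_v; apply: (path_cat (v := pt (estar e'))).
    exact: (seg_path (fits_tip_mid e' b)).
  exact: (@seg_path _ (mid X) (tip X (~~ b))).
by rewrite star_edge_path_h; exact: hdart_path.
Qed.

Lemma star_edge_path_back (a : edge X * bool) :
  sheq (nstar (endpoint a.1 a.2)) (nstar (endpoint a.1 a.2))
    (star_edge_path a ++ star_edge_path (sqdart_rev a)) [::].
Proof.
case: a => e b; have [[e' ->]|[h ->]] := vh_edgeP e; last first.
  by rewrite /sqdart_rev !star_edge_path_h; exact: hdart_back.
rewrite /sqdart_rev /= !star_edge_path_v negbK.
have tm := fits_tip_mid e'.
have mt b' : fits e' (mid X) (tip X b') by [].
apply: (heq_trans (q := seg e' (tip X b) (mid X) ++ seg e' (mid X) (tip X b)));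
  last exact: (seg_back (tm b)).
rewrite -catA; apply: (heq_catl (v := pt (estar e'))); first exact: (seg_path (tm b)).
rewrite catA -[X in heq _ _ _ _ _ _ X]cat0s.
apply: (heq_catr (v := pt (estar e'))); first exact: (seg_back (mt _)).
exact: (seg_path (mt b)).
Qed.

Definition star_path (p : seq (edge X * bool)) : seq (sdart K) :=
  flatten (map star_edge_path p).

Lemma star_path_cat (p1 p2 : seq (edge X * bool)) :
  star_path (p1 ++ p2) = star_path p1 ++ star_path p2.
Proof. by rewrite /star_path map_cat flatten_cat. Qed.

Lemma star_pathP n (r : seq (edge X * bool)) m :
  xpath n r m -> spath (nstar n) (star_path r) (nstar m).
Proof.
elim: r n => [|a r IH] n /=; first by move->.
by move=> [n' [<- <-] /IH]; apply: path_cat; exact: star_edge_pathP.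
Qed.

Definition corner_spoke s (c : bool * bool) :=
  square_spoke s (coord (~~ vaxis s) c) (coord (vaxis s) c).

Definition flip_corner (d : bool) (c : bool * bool) :=
  point d (~~ coord d c) (coord (~~ d) c).

Lemma vhcornerE s (c : bool * bool) :
  vhcorner s (coord (~~ vaxis s) c) (coord (vaxis s) c) = corner s c.
Proof. by rewrite /vhcorner; case: (vaxis s) c => -[]. Qed.

Lemma corner_spoke_path s c :
  spath (sstar s) (corner_spoke s c) (nstar (corner s c)).
Proof. by rewrite -vhcornerE; exact: square_spoke_path. Qed.

Lemma pointK d (c : bool * bool) : point d (coord d c) (coord (~~ d) c) = c.
Proof. by case: d c => -[]. Qed.

Lemma corner_spoke_side s d c : sheq (sstar s) (nstar (corner s (flip_corner d c)))
  (corner_spoke s c ++ star_edge_path (corner_end s d c)) (corner_spoke s (flip_corner d c)).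
Proof.
pose q := coord (vaxis s) c; pose p := coord (~~ vaxis s) c.
have cE : c = point (vaxis s) q p by rewrite /q /p pointK.
have [->|dv] := eqVneq d (vaxis s).
  have fE : flip_corner (vaxis s) c = point (vaxis s) (~~ q) p by [].
  have -> : corner_end s (vaxis s) c = (val (vside s p), vside_end s p q).
    by rewrite -corner_end_v -cE.
  rewrite /corner_spoke star_edge_path_v fE.
  have [-> ->] := coord_point (vaxis s) (~~ q) p; exact: square_spoke_v.
have -> : d = ~~ vaxis s by case: d (vaxis s) dv => [] [].
have fE : flip_corner (~~ vaxis s) c = point (vaxis s) q (~~ p).
  by rewrite /flip_corner /q /p negbK; case: (vaxis s).
have -> : corner_end s (~~ vaxis s) c = (val (hside s q), hside_end s p q).
  by rewrite -corner_end_h -cE.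
rewrite /corner_spoke star_edge_path_h fE.
have [-> ->] := coord_point (vaxis s) q (~~ p); exact: square_spoke_h.
Qed.

Lemma corner_end_path s d c : spath (nstar (corner s c))
  (star_edge_path (corner_end s d c)) (nstar (corner s (flip_corner d c))).
Proof.
have := star_edge_pathP (corner_end s d c).
rewrite endpoint_corner_end; have -> // : endpoint (corner_end s d c).1
  (~~ (corner_end s d c).2) = corner s (flip_corner d c).
by rewrite -corner_side /= -addNb addbK.
Qed.

(** Either the trivial path at a node, or a single edge of some sigma^+ or sigma^- ending at an end
    of the vertical edge. *)
Definition spoke u n (a : seq (sdart K)) : Prop :=
  (u = nstar n /\ a = [::]) \/
  exists e x b, [/\ fits e x (tip X b), local_label e x = u,
    n = endpoint (val e) b & a = seg e x (tip X b)].

Lemma spoke_inv u n a : spoke u n a -> spath u a (nstar n) /\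
  exists a', [/\ spath (nstar n) a' u, sheq (nstar n) (nstar n) (a' ++ a) [::] &
    sheq u u (a ++ a') [::]].
Proof.
case=> [[-> ->]|[e [x [b [xb <- -> ->]]]]].
  by split=> //; exists [::]; split=> //; apply: heq_refl.
have bx := xb; rewrite fitsC in bx; split; first exact: (seg_path xb).
exists (seg e (tip X b) x); split; first exact: (seg_path bx).
  exact: (seg_back bx).
exact: (seg_back xb).
Qed.

Lemma corner_spokeP s c : spoke (sstar s) (corner s c) (corner_spoke s c).
Proof.
right; exists (vside s (coord (~~ vaxis s) c)), (occ s (coord (~~ vaxis s) c)).
exists (vside_end s (coord (~~ vaxis s) c) (coord (vaxis s) c)); split=> //.
  by rewrite fitsC; exact: fits_tip_occ.
by rewrite endpoint_vside vhcornerE.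
Qed.

Lemma spoke_cancel u n a r : spoke u n a -> spath (nstar n) r (nstar n) ->
  sheq u (nstar n) (a ++ r) a -> sheq (nstar n) (nstar n) r [::].
Proof.
move=> /spoke_inv[ua [a' [a'u a'a _]]] nr ara.
apply: (heq_trans (q := a' ++ a ++ r)); last exact: heq_trans (heq_catl a'u ara) a'a.
rewrite catA -[X in heq _ _ _ _ _ X]cat0s; apply: heq_sym; exact: heq_catr a'a nr.
Qed.

(** Sweeping a spoke from s^* once round the square brings it back to itself up to homotopy, and
    cancelling the spoke contracts the boundary. *)
Lemma star_path_boundary n r : square_boundary r -> xpath n r n ->
  sheq (nstar n) (nstar n) (star_path r) [::].
Proof.
move=> [s rE] rn.
pose c0 := (false, false); pose c1 := (true, false).
pose c2 := (true, true); pose c3 := (false, true).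
have nE : n = corner s c0.
  by move: (rn); rewrite rE => -[n' [<- _] _]; rewrite endpoint_corner_end.
rewrite nE.
have S0 := corner_spoke_path s c0.
have step c c' d a : flip_corner d c = c' ->
    sheq (sstar s) (nstar (corner s c)) (corner_spoke s c0 ++ a) (corner_spoke s c) ->
    sheq (sstar s) (nstar (corner s c'))
      (corner_spoke s c0 ++ a ++ star_edge_path (corner_end s d c)) (corner_spoke s c').
  move=> <- H; rewrite catA; apply: heq_trans (corner_spoke_side s d c).
  by apply: heq_catr H _; exact: corner_end_path.
have L : sheq (sstar s) (nstar (corner s c0))
    (corner_spoke s c0 ++ star_path r) (corner_spoke s c0).
  have -> : star_path r = ((star_edge_path (corner_end s false c0) ++
      star_edge_path (corner_end s true c1)) ++
      star_edge_path (corner_end s false c2)) ++ star_edge_path (corner_end s true c3).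
    by rewrite rE /star_path /= cats0 !catA.
  (* The sides are peeled off starting from the last; the axes alternate as in [square_boundary]. *)
  apply: (step c3 c0 true) => //; apply: (step c2 c3 false) => //.
  apply: (step c1 c2 true) => //.
  exact: (corner_spoke_side s false c0).
apply: spoke_cancel (corner_spokeP s c0) _ L.
by have := star_pathP rn; rewrite nE.
Qed.

Lemma xpath_end r n m m' : xpath n r m -> xpath n r m' -> m = m'.
Proof.
elim: r n => [|a r IH] n /=; first by move=> -> ->.
by move=> [k [_ <-] km] [k' [_ <-] km']; exact: IH km km'.
Qed.

Lemma xpath_start r n n' m : xpath n r m -> xpath n' r m -> n = n'.
Proof.
case: r => [|a r] /=; first by move=> -> ->.
by move=> [k [<- _] _] [k' [<- _] _].
Qed.

Lemma star_path_elementary n m r1 r2 :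
  elementary_homotopy (@sqdart_joins X) (@sqdart_rev X) (@square_boundary X) n m r1 r2 ->
  sheq (nstar n) (nstar m) (star_path r1) (star_path r2).
Proof.
move=> [P1 P2 [a [b [r [r1E r2E rE]]]]]; subst r1 r2.
(* The deleted part [r] is a loop: [a] determines where it ends, and [b], with its end [m] fixed,
   determines where it starts. *)
have [n1 na /edge_path_cat[n2 nr n2b]] := proj1 (edge_path_cat _ _ _ _ _) P1.
have [k ak kb] := proj1 (edge_path_cat _ _ _ _ _) P2.
have kn1 := xpath_end ak na; subst k; have n12 := xpath_start n2b kb; subst n2.
rewrite !star_path_cat; apply: heq_catl; first exact: star_pathP na.
rewrite -[X in heq _ _ _ _ _ _ X]cat0s; apply: heq_catr; last exact: star_pathP n2b.
case: rE nr => [[d ->]|br] nr; last exact: star_path_boundary.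
rewrite /star_path /= cats0; case: nr => k [<- _] _; exact: star_edge_path_back.
Qed.

(** The closure relates sequences that may fail to be paths, so the induction also carries that both
    sides are paths or neither is. *)
Lemma star_path_homotopic n m r1 r2 :
  homotopic (@sqdart_joins X) (@sqdart_rev X) (@square_boundary X) n m r1 r2 ->
  xpath n r1 m -> sheq (nstar n) (nstar m) (star_path r1) (star_path r2).
Proof.
move=> H P; suff [_ /(_ P)//] : (xpath n r1 m <-> xpath n r2 m) /\
  (xpath n r1 m -> sheq (nstar n) (nstar m) (star_path r1) (star_path r2)).
elim: H {P} => [a b ab|a|a b _ [PE IH]|a b c _ [PE1 IH1] _ [PE2 IH2]].
- have [Pa Pb _] := ab; split=> // _; exact: star_path_elementary.
- by split=> // Pa; apply: heq_refl; exact: star_pathP.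
- by split=> [|Pb]; [exact: iff_sym|exact: heq_sym (IH (proj2 PE Pb))].
- split=> [|Pa]; first exact: iff_trans PE1 PE2.
  exact: heq_trans (IH1 Pa) (IH2 (proj1 PE1 Pa)).
Qed.

(** * Sliding along spokes *)

Definition linked u n a m a' : Prop := exists r,
  xpath n r m /\ sheq u (nstar m) (a ++ star_path r) a'.

Lemma linked_refl u n a : spoke u n a -> linked u n a n a.
Proof.
move=> /spoke_inv[ua _]; exists [::]; split=> //.
by rewrite cats0; exact: heq_refl.
Qed.

Lemma linked_trans u n a m (b : seq (sdart K)) k c :
  linked u n a m b -> linked u m b k c -> linked u n a k c.
Proof.
move=> [r [nr ab]] [r' [mr' bc]]; exists (r ++ r').
split; first exact: path_cat nr mr'.
rewrite star_path_cat catA; apply: heq_trans bc.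
exact: heq_catr ab (star_pathP mr').
Qed.

Lemma corner_spoke_flip s d c : linked (sstar s) (corner s c) (corner_spoke s c)
  (corner s (flip_corner d c)) (corner_spoke s (flip_corner d c)).
Proof.
exists [:: corner_end s d c]; split; last first.
  by rewrite /star_path /= cats0; exact: corner_spoke_side.
exists (corner s (flip_corner d c)) => //; split; first exact: endpoint_corner_end.
by rewrite -corner_side /= -addNb addbK.
Qed.

(** The two coordinates are corrected one after the other, each by at most one side of the
    square. *)
Lemma corner_spoke_linked s c c' : linked (sstar s) (corner s c) (corner_spoke s c)
  (corner s c') (corner_spoke s c').
Proof.
have fix1 d c1 : coord d c1 = coord d c' \/ coord d (flip_corner d c1) = coord d c'.
  rewrite /flip_corner; have [-> _] := coord_point d (~~ coord d c1) (coord (~~ d) c1).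
  by case: (coord d c1) (coord d c') => [] []; auto.
have step d c1 : exists c2, [/\ coord d c2 = coord d c',
    coord (~~ d) c2 = coord (~~ d) c1 & linked (sstar s) (corner s c1) (corner_spoke s c1)
      (corner s c2) (corner_spoke s c2)].
  have [E|E] := fix1 d c1; first by exists c1; split=> //; exact/linked_refl/corner_spokeP.
  exists (flip_corner d c1); split=> //; last exact: corner_spoke_flip.
  exact: (coord_point d _ _).2.
have [c1 [E1 _ L1]] := step false c; have [c2 [E2 E2' L2]] := step true c1.
have -> : c' = c2 by case: c2 c' c1 E1 E2 E2' {L1 L2 step fix1} => ? ? [? ?] [? ?] /= -> -> ->.
exact: linked_trans L1 L2.
Qed.

Lemma spoke_sstar s n a : spoke (sstar s) n a ->
  exists c, n = corner s c /\ a = corner_spoke s c.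
Proof.
case=> [[]//|[e [x [b [xb xs -> ->]]]]].
case: x xb xs => [[b'|[s' p]]|] xb //= [sE]; subst s'.
have /eqP eE : vside s p == e by case/and4P: xb.
subst e; pose q := b (+) side_flip s (vaxis s) p.
have bE : b = vside_end s p q by rewrite /vside_end addbK.
exists (point (vaxis s) q p); rewrite /corner_spoke.
have [-> ->] := coord_point (vaxis s) q p.
by rewrite bE endpoint_vside.
Qed.

(** A node has only the trivial spoke, as two ends of an edge are never joined by [fits]. The spokes
    at e^* are the halves of [e], which differ by [e] itself, and those at s^* lead to the corners
    of [s]. *)
Lemma spokes_linked u n a m (b : seq (sdart K)) : spoke u n a -> spoke u m b -> linked u n a m b.
Proof.
move=> sa sb; case: u sa sb => [[k|e]|s] sa sb.
- have nodeP n' a' : spoke (nstar k) n' a' -> n' = k /\ a' = [::].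
    case=> [[[->] ->]//|[e [x [b' [xb xk _ _]]]]].
    by case: x xb xk => [[b''|[s' p]]|] // /and4P[].
  have [nE aE] := nodeP _ _ sa; have [mE bE] := nodeP _ _ sb; subst.
  exact: linked_refl.
- have edgeP n' a' : spoke (estar e) n' a' -> exists b',
      n' = endpoint (val e) b' /\ a' = seg e (mid X) (tip X b').
    case=> [[]//|[e' [x [b' [xb xk -> ->]]]]].
    by case: x xb xk => [[b''|[s' p]]|] //= _ [->]; exists b'.
  have [c [nE aE]] := edgeP _ _ sa; have [d [mE bE]] := edgeP _ _ sb; subst.
  have [<-|dc] := eqVneq c d; first exact: linked_refl.
  have {dc sb} -> : d = ~~ c by case: c d dc {sa sb} => [] [].
  exists [:: (val e, c)]; split; first by exists (endpoint (val e) (~~ c)).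
  rewrite /star_path /= cats0 star_edge_path_v catA -[X in heq _ _ _ _ _ _ X]cat0s.
  have mt b' : fits e (mid X) (tip X b') by [].
  apply: (heq_catr (v := pt (estar e))); first exact: (seg_back (mt c)).
  exact: (seg_path (mt (~~ c))).
- have [c [-> ->]] := spoke_sstar sa; have [d [-> ->]] := spoke_sstar sb.
  exact: corner_spoke_linked.
Qed.

Lemma spoke_ex u : exists n a, spoke u n a.
Proof.
case: u => [[n|e]|s].
- by exists n, [::]; left.
- by exists (endpoint (val e) true), (seg e (mid X) (tip X true)); right;
    exists e, (mid X), true.
- by exists (corner s (true, true)), (corner_spoke s (true, true)); exact: corner_spokeP.
Qed.

(** The spokes are part of the existential data; [spokes_linked] later allows them to be exchanged
    at the cost of a path in X. *)
Definition carried u v (p : seq (sdart K)) : Prop := exists n m a (b : seq (sdart K)) r,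
  [/\ spoke u n a, spoke v m b, xpath n r m & sheq u (nstar m) (p ++ b) (a ++ star_path r)].

Lemma sface_dartE (c : star_face X) (x y : star_set c)
    (xy : fits (star_edge c) (fsval x) (fsval y)) :
  #|star_vert (SFace c)| = 2 ->
  existT (fun t => (vert t * vert t)%type) (SFace c : simplex K) (x, y) = fits_dart xy.
Proof.
rewrite /= -cardfE => c2; apply: sface_dart_eq => //.
apply/esym/eqP; rewrite eqEfcard c2 cardfs2; apply/andP; split.
  by apply/fsubsetP => z; rewrite inE => /orP[] /fset1P ->; exact: valP.
by case/and4P: xy => ->.
Qed.

(** Both ends have spokes to one common end of [e], so the path in X is empty. That end is [x] or
    [y] if one of them is an end of [e]; otherwise [tip X true] is an arbitrary choice and a
    triangle closes up. *)
Lemma seg_carried e x y : fits e x y ->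
  carried (local_label e x) (local_label e y) (seg e x y).
Proof.
move=> xy.
have sp z b : fits e z (tip X b) ->
    spoke (local_label e z) (endpoint (val e) b) (seg e z (tip X b)).
  by move=> zb; right; exists e, z, b.
have tipP z : is_tip z -> exists b, z = tip X b by case: z => [[b|]|] //; exists b.
have [/tipP[b xE]|xt] := boolP (is_tip x).
  subst x; have yx := xy; rewrite fitsC in yx.
  exists (endpoint (val e) b), (endpoint (val e) b), [::], (seg e y (tip X b)), [::].
  split; [by left|exact: sp|by []|]; exact: (seg_back xy).
have [/tipP[b yE]|yt] := boolP (is_tip y).
  subst y; exists (endpoint (val e) b), (endpoint (val e) b), (seg e x (tip X b)), [::], [::].
  split; [exact: sp|by left|by []|]; apply: heq_refl; rewrite cats0; exact: (seg_path xy).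
have ft z z' : fits e z z' -> ~~ is_tip z -> fits e z (tip X true).
  by move=> /and4P[_ ze _ _] zt; apply/and4P; split=> //; case: z zt {ze} => [[]|].
have xt' := ft _ _ xy xt; have yt' : fits e y (tip X true).
  by apply: ft yt; rewrite fitsC; exact: xy.
exists (endpoint (val e) true), (endpoint (val e) true), (seg e x (tip X true)),
  (seg e y (tip X true)), [::].
split; [exact: sp|exact: sp|by []|]; rewrite cats0; exact: (seg_triangle xy yt' xt').
Qed.

Lemma dart_carried d (u' v' : simplex K) : sdart_joins d u' v' ->
  exists u v, [/\ u' = pt u, v' = pt v & carried u v [:: d]].
Proof.
case: d => t [x y] [/= t2 xy /star_vertex_atP -> /star_vertex_atP ->].
exists (star_label (x : star_vert t)), (star_label (y : star_vert t)); split=> //.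
case: t x y t2 xy => [w|h|s q|c] x y t2 xy.
- by move: t2; rewrite /= card_unit.
- have yE : y = ~~ x by case: x y xy => [] [].
  subst y; exists (endpoint (val h) x), (endpoint (val h) (~~ x)), [::], [::], [:: (val h, x)].
  split; [by left|by left|by exists (endpoint (val h) (~~ x))|].
  by rewrite /star_path /= star_edge_path_h; apply: heq_refl; exact: hdart_path.
- by move: t2; rewrite /= card_option card_bool.
have xyf : fits (star_edge c) (fsval x) (fsval y).
  by apply: star_face_fits; rewrite eq_sym.
rewrite (sface_dartE xyf t2) -(segE xyf).
rewrite -[star_label _]/(local_label (star_edge c) (fsval x)).
rewrite -[star_label y]/(local_label (star_edge c) (fsval y)).
exact: seg_carried.
Qed.

(** At the vertex where two pieces meet, their spokes [b] and [b'] may differ, and sliding one to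
    the other inserts [r''] between the two paths in X. *)
Lemma path_carried u v (p : seq (sdart K)) : spath u p v -> carried u v p.
Proof.
elim: p u => [|d p IH] u /=.
  case=> uv; subst v; have [n [a ua]] := spoke_ex u.
  exists n, n, a, a, [::]; split=> //; rewrite cats0; apply: heq_refl.
  by have [] := spoke_inv ua.
move=> [w' dw' wv]; have [u1 [w [[uE] wE dc]]] := dart_carried dw'; subst u1 w'.
have [n [k [a [b [r [ua wb nr ab]]]]]] := dc.
have [k' [m [b' [c [r' [wb' vc kr' bc]]]]]] := IH _ wv.
have [r'' [kr'' bb']] := spokes_linked wb wb'.
exists n, m, a, c, (r ++ r'' ++ r'); split=> //.
  by apply: path_cat nr (path_cat kr'' kr').
have du : spath u [:: d] w by exists (pt w).
apply: (heq_trans (q := [:: d] ++ b' ++ star_path r')); first exact: heq_catl du bc.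
apply: (heq_trans (q := [:: d] ++ (b ++ star_path r'') ++ star_path r')).
  by apply: heq_sym; apply: heq_catl du (heq_catr bb' (star_pathP kr')).
rewrite !star_path_cat !catA -(catA _ (star_path r'')).
rewrite -[X in heq _ _ _ _ _ _ X](catA _ (star_path r'')).
apply: heq_catr ab _; rewrite -star_path_cat; apply: star_pathP; exact: path_cat kr'' kr'.
Qed.

(** * Connectedness and simple connectedness of X^* *)

Lemma star_connected : sqconnected X -> sconnected K.
Proof.
move=> [[n _] conn]; split; first by exists (pt (nstar n)); rewrite /is_vertex /= card_unit.
move=> u' v' /is_vertexP[u ->] /is_vertexP[v ->].
have [k [a /spoke_inv[ua _]]] := spoke_ex u.
have [m [b /spoke_inv[_ [b' [mb' _ _]]]]] := spoke_ex v.
have [r kr] := conn k m I I.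
by exists (a ++ star_path r ++ b'); apply: path_cat ua (path_cat (star_pathP kr) mb').
Qed.

(** Carrying the loop [p] and sliding the final spoke back to the initial one gives [p ++ a]
    homotopic to [a] followed by the image of a loop of X. That loop contracts in X, and [a] is
    cancelled. *)
Lemma star_simply_connected : sqsimply_connected X -> ssimply_connected K.
Proof.
(* The empty path may be based at any simplex; a nonempty one starts at a vertex. *)
move=> sc u' [|d p] P; first exact: rst_refl.
have [u uE] : exists u, u' = pt u.
  by case: (P) => w /dart_carried[u [_ [-> _ _]]] _; exists u.
subst u'; move: (d :: p) P => {d} {}p P.
have [n [m [a [b [r [ua ub nr pb]]]]]] := path_carried P.
have [r' [mr' ba]] := spokes_linked ub ua.
have [[upath [a' [na' a'a aa']]] [ubpath _]] := (spoke_inv ua, spoke_inv ub).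
have nn := path_cat nr mr'.
have pa : sheq u (nstar n) (p ++ a) a.
  apply: (heq_trans (q := p ++ b ++ star_path r')).
    by apply: heq_sym; exact: heq_catl P ba.
  rewrite catA; apply: (heq_trans (q := (a ++ star_path r) ++ star_path r')).
    exact: heq_catr pb (star_pathP mr').
  rewrite -catA -star_path_cat -[X in heq _ _ _ _ _ _ X]cats0.
  exact: heq_catl upath (star_path_homotopic (sc _ _ nn) nn).
have [_ _ //] : sheq u u p [::].
apply: (heq_trans (q := p ++ a ++ a')).
  by rewrite -[X in heq _ _ _ _ _ X]cats0; apply: heq_sym; exact: heq_catl P aa'.
by rewrite catA; apply: heq_trans aa'; exact: heq_catr pa na'.
Qed.

End StarPaths.

(** * The induced action *)

Section StarAction.
Variables (G : groupType) (X : vhcomplex) (a : vhaction G X).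
Implicit Types (g k : G) (s : square X) (p q b : bool) (e : vedge X) (h : hedge X).
Implicit Types (x y : local_vertex X) (w : star_vertex X) (t : star_simplex X).

Notation K := (simplexification X).

(** [vidx] and [hidx] are the actions on the horizontal and the vertical coordinate of a corner. The
    value [true] of the other coordinate is immaterial by [corner_actE]. *)
Definition vidx g s p : bool :=
  coord (~~ vaxis (qact a g s)) (corner_act a g s (point (vaxis s) true p)).

Definition hidx g s q : bool :=
  coord (vaxis (qact a g s)) (corner_act a g s (point (vaxis s) q true)).

(** Some side is the image by [eact_side]; since vertical edges stay vertical, its axis can only be
    [d']. *)
Lemma eact_side_axis g s d p d' :
  (d' == vaxis (qact a g s)) = (d == vaxis s) -> exists p',
  eact a g (side s d p) = side (qact a g s) d' p' /\
  forall q, corner_act a g s (point d q p) =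
    point d' (end_act a g (side s d p) (q (+) side_flip s d p) (+)
      side_flip (qact a g s) d' p') p'.
Proof.
move=> dd'; have [d'' [p' [eE cE]]] := eact_side a g s d p.
have dE : d'' = d'.
  have := congr1 (@vertical X) eE; rewrite eact_vertical !vertical_side -dd'.
  by case: d'' d' (vaxis _) {cE eE dd'} => [] [] [].
subst d''; exists p'; split=> // q.
by have := cE (q (+) side_flip s d p); rewrite /side_map addbK.
Qed.

Lemma eact_vside g s p : exists p',
  eact a g (val (vside s p)) = val (vside (qact a g s) p') /\
  forall q, corner_act a g s (point (vaxis s) q p) =
    point (vaxis (qact a g s)) (end_act a g (val (vside s p)) (vside_end s p q) (+)
      side_flip (qact a g s) (vaxis (qact a g s)) p') p'.
Proof. by apply: eact_side_axis; rewrite !eqxx. Qed.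

Lemma pointC d u v : point (~~ d) u v = point d v u.
Proof. by case: d. Qed.

Lemma eact_hside g s q : exists q',
  eact a g (val (hside s q)) = val (hside (qact a g s) q') /\
  forall p, corner_act a g s (point (vaxis s) q p) =
    point (vaxis (qact a g s)) q' (end_act a g (val (hside s q)) (hside_end s p q) (+)
      side_flip (qact a g s) (~~ vaxis (qact a g s)) q').
Proof.
have [|q' [E cE]] := @eact_side_axis g s (~~ vaxis s) q (~~ vaxis (qact a g s)).
  by case: (vaxis s) (vaxis _) => [] [].
by exists q'; split=> // p; have := cE p; rewrite !pointC.
Qed.

(** Vertical sides go to vertical sides and horizontal ones to horizontal ones, so each new
    coordinate depends on one old coordinate only. *)
Lemma corner_actE g s p q : corner_act a g s (point (vaxis s) q p) =
  point (vaxis (qact a g s)) (hidx g s q) (vidx g s p).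
Proof.
have [p' [_ vE]] := eact_vside g s p; have [q' [_ hE]] := eact_hside g s q.
have cp d u v := coord_point d u v.
have -> : hidx g s q = q' by rewrite /hidx hE (proj1 (cp _ _ _)).
have -> : vidx g s p = p' by rewrite /vidx vE (proj2 (cp _ _ _)).
have := hE p; rewrite vE => /(congr1 (coord (vaxis (qact a g s)))).
by rewrite !(proj1 (cp _ _ _)) => ->.
Qed.

Definition vedge_act g e : vedge X :=
  exist _ (eact a g (val e)) (etrans (eact_vertical a g (val e)) (valP e)).

Definition hedge_act g h : hedge X :=
  exist _ (eact a g (val h)) (etrans (congr1 negb (eact_vertical a g (val h))) (valP h)).

Lemma point_inj d u v u' v' : point d u v = point d u' v' -> u = u' /\ v = v'.
Proof. by case: d => -[]. Qed.

Lemma vside_act g s p : vedge_act g (vside s p) = vside (qact a g s) (vidx g s p) /\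
  forall q, end_act a g (val (vside s p)) (vside_end s p q) =
    vside_end (qact a g s) (vidx g s p) (hidx g s q).
Proof.
have [p' [eE cE]] := eact_vside g s p.
have pE : vidx g s p = p'.
  by have := cE true; rewrite corner_actE => /point_inj[].
split=> [|q]; first by apply: val_inj; rewrite /= pE.
by have := cE q; rewrite corner_actE pE => /point_inj[-> _]; rewrite /vside_end addbK.
Qed.

Lemma hside_act g s q : hedge_act g (hside s q) = hside (qact a g s) (hidx g s q) /\
  forall p, end_act a g (val (hside s q)) (hside_end s p q) =
    hside_end (qact a g s) (vidx g s p) (hidx g s q).
Proof.
have [q' [eE cE]] := eact_hside g s q.
have qE : hidx g s q = q'.
  by have := cE true; rewrite corner_actE => /point_inj[].
split=> [|p]; first by apply: val_inj; rewrite /= qE.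
by have := cE p; rewrite corner_actE qE => /point_inj[_ ->]; rewrite /hside_end addbK.
Qed.

Lemma idx1 s p q : vidx 1%g s p = p /\ hidx 1%g s q = q.
Proof.
have := corner_actE 1%g s p q; rewrite corner_act1.
by rewrite [qact a 1%g s]qact1 => /point_inj[<- <-].
Qed.

Lemma idxM g k s p q :
  vidx (g * k)%g s p = vidx g (qact a k s) (vidx k s p) /\
  hidx (g * k)%g s q = hidx g (qact a k s) (hidx k s q).
Proof.
have := corner_actE (g * k)%g s p q; rewrite corner_actM !corner_actE.
by rewrite [qact a (g * k)%g s]qactM => /point_inj[<- <-].
Qed.

Definition local_act g e x : local_vertex X :=
  match x with
  | None => mid X
  | Some (inl b) => tip X (end_act a g (val e) b)
  | Some (inr (s, p)) => occ (qact a g s) (vidx g s p)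
  end.

Lemma vedge_act1 e : vedge_act 1%g e = e.
Proof. by apply: val_inj; exact: eact1. Qed.

Lemma vedge_actM g k e : vedge_act (g * k)%g e = vedge_act g (vedge_act k e).
Proof. by apply: val_inj; exact: eactM. Qed.

Lemma hedge_act1 h : hedge_act 1%g h = h.
Proof. by apply: val_inj; exact: eact1. Qed.

Lemma hedge_actM g k h : hedge_act (g * k)%g h = hedge_act g (hedge_act k h).
Proof. by apply: val_inj; exact: eactM. Qed.

Lemma local_act1 e x : local_act 1%g e x = x.
Proof.
case: x => [[b|[s p]]|] //=; first by rewrite end_act1.
by rewrite qact1 (proj1 (idx1 s p p)).
Qed.

Lemma local_actM g k e x :
  local_act (g * k)%g e x = local_act g (vedge_act k e) (local_act k e x).
Proof.
case: x => [[b|[s p]]|] //=; first by rewrite end_actM.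
by rewrite qactM (proj1 (idxM g k s p p)).
Qed.

Lemma local_act_inj g e : injective (local_act g e).
Proof.
move=> x y xy; rewrite -(local_act1 e x) -(local_act1 e y) -(mulVg g).
by rewrite !local_actM xy.
Qed.

Lemma fits_act g e x y : fits e x y ->
  fits (vedge_act g e) (local_act g e x) (local_act g e y).
Proof.
have adj z : adjacent_to e z -> adjacent_to (vedge_act g e) (local_act g e z).
  case: z => [[b|[s p]]|] //= /eqP <-; by rewrite (proj1 (vside_act g s p)).
have tipE z : is_tip (local_act g e z) = is_tip z by case: z => [[b|[s p]]|].
move=> /and4P[xy ex ey xyt]; apply/and4P; split; [|exact: adj|exact: adj|].
  by apply: contra xy => /eqP/local_act_inj ->.
by rewrite !tipE.
Qed.

Definition local_image g e (B : {fset local_vertex X}) : {fset local_vertex X} :=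
  [fset local_act g e x | x in B]%fset.

Lemma face_act_subproof g (c : star_face X) :
  is_star_face (vedge_act g (star_edge c), local_image g (star_edge c) (star_set c)).
Proof.
have c1 : 1 < #|` local_image g (star_edge c) (star_set c)|.
  by rewrite card_imfset; [exact: star_set_gt1|exact: local_act_inj].
apply/(is_star_faceP _ c1) => x y /imfsetP[x' /= x'c ->] /imfsetP[y' /= y'c ->] xy.
apply: fits_act; have /(is_star_faceP _ (star_set_gt1 c)) cP :
    is_star_face (star_edge c, star_set c).
  by rewrite -surjective_pairing; exact: (valP c).
by apply: cP => //; apply: contraNneq xy => ->.
Qed.

Definition face_act g (c : star_face X) : star_face X := 
  exist _ (vedge_act g (star_edge c), local_image g (star_edge c) (star_set c))
    (face_act_subproof g c).

Definition vertex_act g w : star_vertex X :=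
  match w with
  | inl (inl n) => nstar (nact a g n)
  | inl (inr e) => estar (vedge_act g e)
  | inr s => sstar (qact a g s)
  end.

Definition simplex_act g t : star_simplex X :=
  match t with
  | Vtx w => Vtx (vertex_act g w)
  | HEdge h => HEdge (hedge_act g h)
  | HTri s q => HTri (qact a g s) (hidx g s q)
  | SFace c => SFace (face_act g c)
  end.

Definition vert_act g t : star_vert t -> star_vert (simplex_act g t) :=
  match t with
  | Vtx w => id
  | HEdge h => end_act a g (val h)
  | HTri s q => omap (vidx g s)
  | SFace c => fun x : star_set c =>
      [` in_imfset imfset_key (local_act g (star_edge c)) (valP x)]%fset
  end.

Lemma face_act1 c : face_act 1%g c = c.
Proof.
apply: star_face_eq; first exact: vedge_act1.
apply/fsetP => x; apply/imfsetP/idP => [[y /= yc ->]|xc]; first by rewrite local_act1.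
by exists x => //=; rewrite local_act1.
Qed.

Lemma face_actM g k c : face_act (g * k)%g c = face_act g (face_act k c).
Proof.
apply: star_face_eq; first exact: vedge_actM.
apply/fsetP => x; apply/imfsetP/imfsetP => [[y /= yc ->]|[y /= /imfsetP[z /= zc ->] ->]].
  exists (local_act k (star_edge c) y); last exact: local_actM.
  by apply/imfsetP; exists y.
by exists z => //=; rewrite local_actM.
Qed.

Lemma simplex_act1 t : simplex_act 1%g t = t.
Proof.
case: t => [[[n|e]|s]|h|s q|c] /=.
- by rewrite nact1.
- by rewrite vedge_act1.
- by rewrite qact1.
- by rewrite hedge_act1.
- by rewrite qact1 (proj2 (idx1 s q q)).
- by rewrite face_act1.
Qed.

Lemma simplex_actM g k t : simplex_act (g * k)%g t = simplex_act g (simplex_act k t).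
Proof.
case: t => [[[n|e]|s]|h|s q|c] /=.
- by rewrite nactM.
- by rewrite vedge_actM.
- by rewrite qactM.
- by rewrite hedge_actM.
- by rewrite qactM (proj2 (idxM g k s q q)).
- by rewrite face_actM.
Qed.

Notation vert_of := (fun t => star_vert t : Type).

Lemma vert_eq_SFace (c c' : star_face X) (x : star_set c) (x' : star_set c') :
  c = c' -> fsval x = fsval x' ->
  existT vert_of (SFace c) x = existT vert_of (SFace c') x'.
Proof. by move=> cc'; subst c' => /val_inj ->. Qed.

Lemma vert_eq_HEdge h h' b b' : h = h' -> b = b' ->
  existT vert_of (HEdge h) b = existT vert_of (HEdge h') b'.
Proof. by move=> -> ->. Qed.

Lemma vert_eq_HTri s s' q q' (x x' : option bool) : s = s' -> q = q' -> x = x' ->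
  existT vert_of (HTri s q) x = existT vert_of (HTri s' q') x'.
Proof. by move=> -> -> ->. Qed.

Lemma vert_act1 t (x : star_vert t) :
  existT vert_of (simplex_act 1%g t) (vert_act 1%g x) = existT vert_of t x.
Proof.
case: t x => [w|h|s q|c] x.
- have := simplex_act1 (Vtx w) => /= -[->]; by [].
- by apply: vert_eq_HEdge; [exact: hedge_act1|exact: end_act1].
- apply: vert_eq_HTri; [exact: qact1|exact: (proj2 (idx1 s q q))|].
  by case: x => //= p; rewrite (proj1 (idx1 s p p)).
- by apply: vert_eq_SFace; [exact: face_act1|exact: local_act1].
Qed.

Lemma vert_actM g k t (x : star_vert t) :
  existT vert_of (simplex_act (g * k)%g t) (vert_act (g * k)%g x) =
  existT vert_of (simplex_act g (simplex_act k t)) (vert_act g (vert_act k x)).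
Proof.
case: t x => [w|h|s q|c] x.
- have := simplex_actM g k (Vtx w) => /= -[->]; by [].
- by apply: vert_eq_HEdge; [exact: hedge_actM|exact: end_actM].
- apply: vert_eq_HTri; [exact: qactM|exact: (proj2 (idxM g k s q q))|].
  by case: x => //= p; rewrite (proj1 (idxM g k s p p)).
- by apply: vert_eq_SFace; [exact: face_actM|exact: local_actM].
Qed.

Lemma star_label_act g t (x : star_vert t) :
  star_label (vert_act g x) = vertex_act g (star_label x).
Proof.
case: t x => [w|h|s q|c] x //=.
- by rewrite nact_endpoint.
- case: x => [p|] //=.
  by rewrite -!endpoint_vside -(proj1 (vside_act g s p)) -(proj2 (vside_act g s p)) nact_endpoint.
- by case: (fsval x) => [[b|[s p]]|] //=; rewrite nact_endpoint.
Qed.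

(** A point is attached wherever its label sits, so equivariance of labels settles that case; the
    other attaching maps are given by the same formulas at the transported indices. *)
Lemma vert_act_attach g t u (f : {ffun star_vert t -> star_vert u}) :
  star_attach f ->
  exists2 f' : {ffun star_vert (simplex_act g t) -> star_vert (simplex_act g u)},
    star_attach f' & forall z, f' (vert_act g z) = vert_act g (f z).
Proof.
case: t f => [w|h|s q|c] f.
- move=> ff; exists [ffun=> vert_act g (f tt)]; last by move=> []; rewrite ffunE.
  have := star_attach_label ff tt => /= fw.
  have /= L := star_label_act g (f tt); rewrite fw in L.
  by case: u f ff fw L => [w'|h'|s' q'|c'] f //= ff fw; rewrite ffunE.
- case: u f => [w'|h'|s' q'|c'] f //= [hE fE].
  have [hE' eE'] := hside_act g s' q'.
  exists [ffun b => Some (b (+) side_flip (qact a g s') (~~ vaxis (qact a g s')) (hidx g s' q'))].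
    by split=> [|p]; [rewrite hE|rewrite ffunE addbK].
  move=> b; rewrite ffunE hE -[b](addbK (side_flip s' (~~ vaxis s') q')).
  by rewrite -/(hside_end s' _ q') eE' fE /hside_end addbK.
- by case: u f.
- case: u f => [w'|h'|s' q'|c'] f //=.
  + move=> [p [eE cE fE]]; have [vE eE'] := vside_act g s' p.
    exists [ffun x : star_set (face_act g c) =>
      if fsval x == occ (qact a g s') (vidx g s' p) then None else Some (vidx g s' p)].
      exists (vidx g s' p); split=> [||x]; last by rewrite ffunE.
        by rewrite -vE -eE.
      rewrite -eE' /star_set /= -/(star_edge c) -/(star_set c) /local_image cE.
      apply/fsetP => x; rewrite !inE; apply/imfsetP/orP => [[y /=]|].
        by rewrite !inE => /orP[] /eqP -> ->; [left|right]; rewrite /= ?eE.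
      by case=> /eqP ->; [exists (tip X (vside_end s' p q'))|exists (occ s' p)];
        rewrite /= ?inE ?eqxx ?orbT ?eE.
    move=> x; rewrite ffunE fE /=.
    (* Written as a value of [local_act], the tested vertex is compared by injectivity. *)
    rewrite -[occ (qact a g s') _]/(local_act g (star_edge c) (occ s' p)).
    by rewrite (inj_eq (@local_act_inj g (star_edge c))); case: eqP.
  + move=> [eE cc' fE].
    have sub : (star_set (face_act g c) `<=` star_set (face_act g c'))%fset.
      apply/fsubsetP => x /imfsetP[y /= yc ->]; rewrite eE; apply: in_imfset => /=.
      exact: (fsubsetP (fproper_sub cc')).
    exists [ffun x : star_set (face_act g c) => fincl sub x].
      split=> [||x]; [by rewrite /star_edge /= -/(star_edge c) eE| |by rewrite ffunE].
      rewrite fproperEcard sub /= !card_imfset; try exact: local_act_inj.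
      exact: fproper_ltn_card.
    move=> x; apply: val_inj; rewrite ffunE /= fE eE; by [].
Qed.

Definition star_saction : saction G K :=
  @SAction G K simplex_act vert_act simplex_act1 simplex_actM vert_act1 vert_actM
    vert_act_attach.

End StarAction.

(** * Properness and cocompactness of the induced action *)

Section StarGeometric.
Variables (G : groupType) (X : vhcomplex) (a : vhaction G X).
Hypothesis geo : geometric (cell_act a).

Notation K := (simplexification X).
Local Open Scope classical_set_scope.

(** An equivariant choice of a cell of X for each simplex. Faces of sigma^+ and sigma^- need not lie
    in X and are sent to their vertical edge; the aim is to have finite fibres. *)
Definition support_cell (t : star_simplex X) : sqcell X :=
  match t with
  | Vtx (inl (inl n)) => inl (inl n)
  | Vtx (inl (inr e)) => inl (inr (val e))
  | Vtx (inr s) => inr s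
  | HEdge h => inl (inr (val h))
  | HTri s _ => inr s
  | SFace c => inl (inr (val (star_edge c)))
  end.

Lemma support_cell_act g t :
  support_cell (simplex_act a g t) = cell_act a g (support_cell t).
Proof. by case: t => [[[n|e]|s]|h|s q|c]. Qed.

Lemma vidx_surj g s p : exists p0, vidx a g s p0 = p.
Proof.
suff: vidx a g s false != vidx a g s true.
  by case E : (vidx a g s false) p => [] [] //= ne;
    [exists false|exists true|exists true|exists false] => //;
    case: vidx ne.
apply/eqP => E.
have := (idxM a g^-1%g g s false true).1; rewrite E -(idxM a g^-1%g g s true true).1.
by rewrite mulVg !(idx1 a s _ true).1.
Qed.

(** By cocompactness every square is a translate of one of finitely many squares [s0]. If a side of
    the translate by [g] is [e], then [g] moves a vertical side of [s0] to [e], which by properness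
    happens for finitely many [g]. *)
Lemma finite_occurrences (e : vedge X) :
  finite_set [set sp : square X * bool | vside sp.1 sp.2 = e].
Proof.
have [proper [A Af cover]] := geo.
(* Properness is applied to the set of the two edges [vside s0 p0] and [e], which meets its
   translate whenever [g] sends the first to the second. *)
pose F (c : sqcell X) : set (square X * bool) := if c is inr s0 then
  \bigcup_(p0 in [set: bool])
    ((fun g => (qact a g s0, vidx a g s0 p0)) @`
       [set g | ((cell_act a g @` [set inl (inr (val (vside s0 p0))); inl (inr (val e))])
                 `&` [set inl (inr (val (vside s0 p0))); inl (inr (val e))]) !=set0])
  else set0.
apply: (@sub_finite_set _ _ (\bigcup_(c in A) F c)); last first.
  apply: bigcup_finite => // -[[n|e']|s0] _ //=; try exact: finite_set0.
  apply: bigcup_finite; first exact: finite_finset.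
  by move=> p0 _; apply: finite_image; apply: proper; apply: finite_set2.
move=> [s p] /= spE.
have : [set: sqcell X] (inr s) by [].
rewrite -cover => -[g _ [c Ac /=]]; case: c Ac => [[n|e']|s0] As0 //= [sE].
have [p0 pE] := vidx_surj g s0 p.
exists (inr s0) => //; exists p0 => //; exists g; last by rewrite sE pE.
exists (inl (inr (val e))); split; last by right.
exists (inl (inr (val (vside s0 p0)))); first by left.
have [vE _] := vside_act a g s0 p0.
by have := congr1 val vE; rewrite /= -/(val _) => ->; rewrite -spE sE pE.
Qed.

(** Only vertical edges need an argument: by [finite_occurrences] there are finitely many local
    vertices around such an edge, hence finitely many faces. *)
Lemma finite_support (c : sqcell X) : finite_set [set t | support_cell t = c].
Proof.
case: c => [[n|e]|s].
- apply: (@sub_finite_set _ _ [set Vtx (nstar n)]); last exact: finite_set1.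
  by move=> [[[n'|e']|s']|h|s' q|c] //= [->].
- have [[e' ->]|[h ->]] := vh_edgeP e; last first.
    apply: (@sub_finite_set _ _ [set HEdge h]); last exact: finite_set1.
    move=> [[[n'|e']|s']|h'|s' q|c] //= [E].
    + by have /negP[] : ~~ vertical (sval h) := valP h; rewrite -E; exact: (valP e').
    + by congr HEdge; exact: val_inj.
    + by have /negP[] : ~~ vertical (sval h) := valP h; rewrite -E; exact: (valP (star_edge c)).
  have /finite_fsetP[S SE] := finite_occurrences e'.
  pose L : {fset local_vertex X} :=
    ([fset mid X; tip X true; tip X false] `|` [fset occ sp.1 sp.2 | sp in S])%fset.
  have LE x : adjacent_to e' x -> x \in L.
    rewrite inE => xe; apply/orP.
    case: x xe => [[[]|[s p]]|] /=; try by left; rewrite !inE eqxx ?orbT.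
    move=> /eqP sp; right; apply/imfsetP; exists (s, p) => //=.
    by have /seteqP[/(_ (s, p))+ _] := SE; apply.
  (* The default for sets that are not faces is harmless: only values at vertex sets of actual faces
     are used. *)
  pose f (B : {fset local_vertex X}) : star_simplex X :=
    if insub (e', B) is Some c then SFace c else Vtx (estar e').
  apply: (@sub_finite_set _ _ (Vtx (estar e') |` (f @` [set` fpowerset L]))); last first.
    rewrite finite_setU; split; first exact: finite_set1.
    by apply: finite_image; exact: finite_fset.
  move=> [[[n'|e0]|s']|h'|s' q|c] //= [E].
  + by left; congr (Vtx (estar _)); exact: val_inj.
  + by have /negP[] : ~~ vertical (sval h') := valP h'; rewrite E; exact: (valP e').
  have cE : star_edge c = e' by exact: val_inj.
  right; exists (star_set c).
    rewrite /= fpowersetE; apply/fsubsetP => x xc; apply: LE; rewrite -cE.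
    by have /and3P[_ _ /allP] := valP c; apply.
  by rewrite /f -cE -surjective_pairing valK.
apply: (@sub_finite_set _ _ [set Vtx (sstar s); HTri s true; HTri s false]).
  by move=> [[[n'|e']|s']|h'|s' [|]|c] //= [->]; [left; left|left; right|right].
by rewrite !finite_setU; do ![split]; exact: finite_set1.
Qed.

(** Properness is pushed forward along [support_cell], which is equivariant; cocompactness is pulled
    back along it, since its fibres are finite. *)
Lemma star_geometric : geometric (sact (star_saction a)).
Proof.
have [proper [A Af cover]] := geo; split=> [B Bf|].
  apply: sub_finite_set (proper _ (finite_image support_cell Bf)).
  move=> g [_ [[t Bt <-] Bgt]]; exists (support_cell (simplex_act a g t)).
  split; last by exists (simplex_act a g t).
  by exists (support_cell t); [exists t|rewrite support_cell_act].
exists (\bigcup_(c in A) [set t | support_cell t = c]).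
  by apply: bigcup_finite => // c _; exact: finite_support.
apply/seteqP; split=> // t _.
have : [set: sqcell X] (support_cell t) by [].
rewrite -cover => -[g _ [c Ac cE]].
(* Translating [t] back by the inverse of [g] moves its support into [A]. *)
exists g => //; exists (simplex_act a g^-1%g t).
  exists c => //=; rewrite support_cell_act -cE.
  have act1 c' : cell_act a 1%g c' = c'.
    by case: c' => [[n|e]|s] /=; rewrite ?nact1 ?eact1 ?qact1.
  have actM k k' c' : cell_act a (k * k')%g c' = cell_act a k (cell_act a k' c').
    by case: c' => [[n|e]|s] /=; rewrite ?nactM ?eactM ?qactM.
  by rewrite -actM mulVg act1.
by rewrite /= -simplex_actM mulgV simplex_act1.
Qed.

End StarGeometric.

Theorem corollary2p5 (X : vhcomplex) (hX : cat0_vh X) :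
  systolic (simplexification X) /\
  forall (G : groupType) (a : vhaction G X),
    geometric (cell_act a) -> systolic_group G.
Proof.
have [conn sc npc] := hX.
have K6 : systolic (simplexification X).
  split; [exact: star_connected|exact: star_simply_connected|exact: star_locally_6_large].
split=> // G a geo; exists (simplexification X); split=> //.
by exists (star_saction a); exact: star_geometric.
Qed.
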